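(* Let $k$ be a field of characteristic zero and $d,e\ge1$ integers. The image of the fixed point multiplier map $\lambda_{1,(d,e)}:\mathrm{Dyn}_{d,e}\dashrightarrow\mathbb{P}(D_{d+e})$ is the hyperplane defined by $$[(dz^0)^{d+e-1}(dz^1)^1]=0,$$ where $dz^0:=\frac{d}{d+e}dx+\frac{e}{d+e}dy$, $dz^1:=\frac{2}{d+e}dx-\frac{2}{d+e}dy$, and $[(dz^0)^{d+e-1}(dz^1)^1]$ is the homogeneous coordinate function on $\mathbb{P}(D_{d+e})$ that takes the coefficient of $(dz^0)^{d+e-1}dz^1$ when an element of $D_{d+e}$ is written as a polynomial in $dz^0,dz^1$.
   Context: $V_{d,e}$ denotes the $k$-vector space of forms $f=\sum_{0\le i\le d,\,0\le j\le e}a_{ij}x_0^{d-i}x_1^{i}y_0^{e-j}y_1^{j}$, and $\mathrm{Corr}_{d,e}:=\mathbb{P}(V_{d,e})$ is the space of lines in $V_{d,e}$. $\mathrm{SL}_2$ acts linearly on $V_{d,e}$ by simultaneous substitution of the same linear change of variables in $(x_0,x_1)$ and $(y_0,y_1)$ (conjugation action). $\mathrm{Dyn}_{d,e}:=\mathrm{Corr}_{d,e}^{ss}/\!/\mathrm{PGL}_2=\mathrm{Proj}\bigoplus_{n\ge0}H^0(\mathrm{Corr}_{d,e},\mathcal{O}(n))^{\mathrm{SL}_2}$ is the GIT quotient of the semistable locus. $D_n$ is the vector space of homogeneous polynomials of degree $n$ in two formal variables $dx,dy$, and $\mathbb{P}(D_n)$ the space of lines in it. For $f=\sum a_{ij}x_0^{d-i}x_1^iy_0^{e-j}y_1^j\in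 V_{d,e}$ put $F(z_0,z_1)=f(z_0,z_1,z_0,z_1)$, $P=(x_1\partial_{x_1}f-x_0\partial_{x_0}f)|_{x=y=z}=\sum(2i-d)a_{ij}z_0^{d+e-i-j}z_1^{i+j}$ and $Q=(y_1\partial_{y_1}f-y_0\partial_{y_0}f)|_{x=y=z}=\sum(2j-e)a_{ij}z_0^{d+e-i-j}z_1^{i+j}$. The fixed point multiplier map is the rational map $\mathrm{Corr}_{d,e}\dashrightarrow\mathbb{P}(D_{d+e})$, $f\mapsto[\mathrm{res}_{[z_0,z_1]}(F,\;P\,dx+Q\,dy)]$, where $\mathrm{res}_{[z_0,z_1]}$ is the homogeneous resultant (Sylvester determinant) of two binary forms of degree $d+e$ in $z_0,z_1$. It is invariant under the conjugation action and hence induces the rational map $\lambda_{1,(d,e)}:\mathrm{Dyn}_{d,e}\dashrightarrow\mathbb{P}(D_{d+e})$. The resultant is divisible by $a_{00}a_{de}$ as a polynomial in the $a_{ij}$, and the quotient has $\mathrm{SL}_2$-invariant coordinates (in the basis of monomials in $dz^0,dz^1$); these quotient coordinates represent the same rational map. The image of a rational map means the image of its domain of definition. *)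

(* Defs.v *)
From mathcomp Require Import all_boot all_order all_algebra.
From mathcomp Require Import mpoly.

Set Implicit Arguments.
Unset Strict Implicit.
Unset Printing Implicit Defensive.

Import GRing.Theory.
Local Open Scope ring_scope.

(* An element of V_{d,e} over A is given by its matrix of coefficients a i j.
   In {mpoly A[4]} the variables 0, 1, 2, 3 stand for x0, x1, y0, y1; in
   {mpoly A[2]} the variables 0, 1 stand for z0, z1, or for dx, dy. *)
Section Forms.
Variables (A : comNzRingType) (d e : nat).

Let x0 : {mpoly A[4]} := 'X_(inord 0).
Let x1 : {mpoly A[4]} := 'X_(inord 1).
Let y0 : {mpoly A[4]} := 'X_(inord 2).
Let y1 : {mpoly A[4]} := 'X_(inord 3).
Let z0 : {mpoly A[2]} := 'X_(inord 0).
Let z1 : {mpoly A[2]} := 'X_(inord 1).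

Definition corr_form (a : 'M[A]_(d.+1, e.+1)) : {mpoly A[4]} :=
  \sum_(i < d.+1) \sum_(j < e.+1)
     a i j *: (x0 ^+ (d - i) * x1 ^+ i * y0 ^+ (e - j) * y1 ^+ j).

Definition corr_coefs (f : {mpoly A[4]}) : 'M[A]_(d.+1, e.+1) :=
  \matrix_(i, j) f@_[multinom [tuple (d - i)%N; i : nat; (e - j)%N; j : nat]].

Definition corr_act (g : 'M[A]_2) (a : 'M[A]_(d.+1, e.+1)) :
    'M[A]_(d.+1, e.+1) :=
  let r0 := inord 0 : 'I_2 in let r1 := inord 1 : 'I_2 in
  corr_coefs (corr_form a \mPo
    [tuple g r0 r0 *: x0 + g r0 r1 *: x1; g r1 r0 *: x0 + g r1 r1 *: x1;
           g r0 r0 *: y0 + g r0 r1 *: y1; g r1 r0 *: y0 + g r1 r1 *: y1]).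

Definition diag (f : {mpoly A[4]}) : {mpoly A[2]} :=
  f \mPo [tuple z0; z1; z0; z1].

Definition fix_form (a : 'M[A]_(d.+1, e.+1)) := diag (corr_form a).

Definition P_form (a : 'M[A]_(d.+1, e.+1)) :=
  let f := corr_form a in
  diag (x1 * f^`M(inord 1) - x0 * f^`M(inord 0)).

Definition Q_form (a : 'M[A]_(d.+1, e.+1)) :=
  let f := corr_form a in
  diag (y1 * f^`M(inord 3) - y0 * f^`M(inord 2)).

End Forms.

(* Coefficient of z0^(n-l) z1^l. *)
Definition bcoef (A : comNzRingType) (n : nat) (F : {mpoly A[2]}) (l : nat) : A :=
  F@_[multinom [tuple (n - l)%N; l]].

(* Sylvester determinant of two binary forms of degree n, each given by its
   coefficients p l, l <= n, of z0^(n-l) z1^l. The size is always n + n, unlike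
   that of [resultant], which depends on the actual degrees. *)
Definition hresultant (B : comNzRingType) (n : nat) (p q : nat -> B) : B :=
  let band (s : nat -> B) : 'M[B]_(n, n + n) :=
    \matrix_(i < n, j < n + n) if (i <= j <= i + n)%N then s (j - i)%N else 0 in
  \det (col_mx (band p) (band q)).

(* res_{[z0,z1]}(F, P dx + Q dy), as a form in dx, dy with coefficients in A. *)
Definition multiplier_res (A : comNzRingType) (d e : nat)
    (a : 'M[A]_(d.+1, e.+1)) : {mpoly A[2]} :=
  hresultant (d + e)
    (fun l => (bcoef (d + e) (fix_form a) l)%:MP)
    (fun l => bcoef (d + e) (P_form a) l *: 'X_(inord 0)
            + bcoef (d + e) (Q_form a) l *: 'X_(inord 1)).

(* Points of Proj R, for a graded subring R of a polynomial ring: homogeneous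
   primes of R not containing the irrelevant ideal. *)
Record Proj (k : fieldType) (N : nat) (R : {mpoly k[N]} -> Prop) := ProjPoint {
  prime_of :> {mpoly k[N]} -> Prop;
  prime_sub : forall x, prime_of x -> R x;
  prime0 : prime_of 0;
  primeD : forall x y, prime_of x -> prime_of y -> prime_of (x + y);
  primeMl : forall x y, R x -> prime_of y -> prime_of (x * y);
  prime1 : ~ prime_of 1;
  prime_prime : forall x y, R x -> R y ->
    prime_of (x * y) -> prime_of x \/ prime_of y;
  prime_homog : forall x n, prime_of x -> prime_of (pihomog mdeg n x);
  prime_relevant : exists x n,
    [/\ (0 < n)%N, R x, x \is n.-homog & ~ prime_of x]
}.

Section MultiplierMap.
Variables (k : fieldType) (d e : nat).

(* Homogeneous coordinate ring of Corr_{d,e}: the polynomials in the a_ij. *)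
Definition corr_ring := {mpoly k[d.+1 * e.+1]}.

Definition generic_corr : 'M[corr_ring]_(d.+1, e.+1) :=
  \matrix_(i, j) 'X_(mxvec_index i j).

(* Invariance is tested on the k-points of SL_2, which are Zariski dense as
   soon as k is infinite. *)
Definition SL2_invariant (F : corr_ring) : Prop :=
  forall g : 'M[k]_2, \det g = 1 ->
    F \mPo [tuple mxvec (corr_act (map_mx (@mpolyC _ k) g) generic_corr) 0 l
           | l < d.+1 * e.+1] = F.

Definition Dyn := Proj SL2_invariant.

Definition dz0 : {mpoly k[2]} :=
  (d%:R / (d + e)%:R) *: 'X_(inord 0) + (e%:R / (d + e)%:R) *: 'X_(inord 1).

Definition dz1 : {mpoly k[2]} :=
  (2%:R / (d + e)%:R) *: 'X_(inord 0) - (2%:R / (d + e)%:R) *: 'X_(inord 1).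

(* The homogeneous coordinates on P(D_{d+e}) are T_0, ..., T_{d+e}, with T_j the
   coefficient of dz0^(d+e-j) dz1^j. *)
Definition PD := Proj (fun _ : {mpoly k[(d + e).+1]} => True).

Definition D_elt (t : (d + e).+1.-tuple corr_ring) : {mpoly corr_ring[2]} :=
  \sum_(j < (d + e).+1)
    tnth t j *: map_mpoly (@mpolyC _ k) (dz0 ^+ (d + e - j) * dz1 ^+ j).

(* The invariants t, homogeneous of the same degree, are coordinates of the
   multiplier map: [t] and the resultant agree as points of P(D_{d+e}) over the
   fraction field of the ring of polynomials in the a_ij. *)
Definition represents (t : (d + e).+1.-tuple corr_ring) : Prop :=
  [/\ forall j, SL2_invariant (tnth t j),
      exists m, forall j, tnth t j \is m.-homog
    & exists u v : corr_ring,
        [/\ u != 0, v != 0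
          & u *: D_elt t = v *: multiplier_res generic_corr]].

(* The rational map is defined at p when some coordinates representing it do
   not all vanish at p, and its value is then the kernel of T_j |-> t_j mod p
   (as a homogeneous ideal). *)
Definition multiplier_map (p : Dyn) (q : PD) : Prop :=
  exists t : (d + e).+1.-tuple corr_ring,
    [/\ represents t,
        exists j, ~ p (tnth t j)
      & forall F, q F <-> forall n, p (pihomog mdeg n F \mPo t)].

Definition multiplier_image (q : PD) : Prop :=
  exists p : Dyn, multiplier_map p q.

(* The hyperplane [dz0^(d+e-1) dz1] = 0. *)
Definition multiplier_hyperplane (q : PD) : Prop := q 'X_(inord 1).

End MultiplierMap.

(* Main.v *)
(* Put n = d + e.  In the basis dz0, dz1 the pencil P dx + Q dy is
   (z1 F_1 - z0 F_0) dz0 + G dz1, with G = (e P - d Q) / 2 = z0 z1 H and H the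
   first transvectant of f.  If F has the finite nonzero roots al_i and leading
   coefficient c, the resultant divided by a_00 a_de is therefore
     Lambda = c^(n-2) prod_i (2 F'(al_i) dz0 + H(al_i) dz1).
   This expression is invariant under SL_2, since F and H are covariants.  Its
   coefficient of dz0^(n-1) dz1 vanishes because sum_i H(al_i) / F'(al_i) is
   the coefficient of z^(n-1) in H, which has degree at most n - 2.  Both facts
   are proved for the generic f, over a splitting field of its form F.

   Conversely, f |-> (F, H) is onto.  Given a point of the hyperplane, with
   values T_j in its residue field, split sum_j T_j X^(n-j) over an extension.
   If T_0 <> 0, take F with any distinct roots and find H by interpolation; the
   condition T_1 = 0 is what makes deg H <= n - 2.  If T_r is the first nonzero
   T_j, then r >= 2; take F with one r-fold root, where F' vanishes, so that it
   contributes the factor dz1^r, and distinct other roots.  The semistable point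
   is the ideal of the invariants that vanish on the line spanned by such an f. *)

Require Import Defs.
From HB Require Import structures.
From mathcomp Require Import all_boot all_order all_fingroup all_algebra all_field.
From mathcomp Require Import ring zify.
From mathcomp Require Import mpoly.
From Stdlib Require Import Classical ClassicalEpsilon.

Set Implicit Arguments.
Unset Strict Implicit.
Unset Printing Implicit Defensive.

Import GRing.Theory.
Local Open Scope ring_scope.

(** * The resultant in terms of roots *)

(** A named copy of the band inside [hresultant], convertible to it. *)
Definition band (C : comNzRingType) (n : nat) (s : nat -> C) : 'M[C]_(n, n + n) :=
  \matrix_(i < n, j < n + n) if (i <= j <= i + n)%N then s (j - i)%N else 0.

(** Exchanging the two block columns makes the matrix block triangular. The exchange is a product of
    three block unitriangular matrices and a diagonal matrix of determinant [(-1) ^+ n]. *)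
Lemma det_anti_block (C : comNzRingType) (n : nat) (B E D : 'M[C]_n) :
  \det (block_mx 0 B E D) = (-1) ^+ n * \det B * \det E.
Proof.
have swap : block_mx (0 : 'M[C]_n) 1%:M 1%:M (0 : 'M[C]_n) =
    block_mx 1%:M 0 0 (-1)%:M *m (block_mx 1%:M 1%:M 0 1%:M *m
      (block_mx 1%:M 0 (-1)%:M 1%:M *m block_mx 1%:M 1%:M 0 1%:M)).
  rewrite !mulmx_block !(mulmx0, mul0mx, mulmx1, mul1mx, addr0, add0r).
  rewrite (raddfN (@scalar_mx C n)) !mulNmx !mul1mx subrr addNr opprK.
  by rewrite oppr0 addr0.
have -> : block_mx 0 B E D = block_mx B 0 D E *m
    block_mx (0 : 'M[C]_n) 1%:M 1%:M (0 : 'M[C]_n).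
  by rewrite mulmx_block !(mulmx0, mul0mx, mulmx1, mul1mx, addr0, add0r).
rewrite det_mulmx det_lblock swap !det_mulmx !det_ublock !det_lblock !det_scalar.
by rewrite !expr1n !mul1r !mulr1; ring.
Qed.

(** Row [i] of the band holds the coefficients [s] shifted by [i]. When [w] lists the powers of a
    point [x], the sum is [x ^+ i] times the value at [x] of the polynomial with coefficients
    [s]. *)
Lemma sum_band (C : comNzRingType) (n : nat) (s w : nat -> C) (i : 'I_n) :
  \sum_(j < n + n) (band n s) i j * w j = \sum_(l < n.+1) s l * w (i + l)%N.
Proof.
under eq_bigr do rewrite mxE.
rewrite -(big_mkord xpredT (fun j => (if (i <= j <= i + n)%N then s (j - i)%N else 0) * w j)).
have lin : (i <= n + n)%N by have := ltn_ord i; lia.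
rewrite (big_cat_nat _ (n := i)) //= big_nat_cond big1 ?add0r; last first.
  by move=> j /andP[/andP[_ ji] _]; rewrite leqNgt ji mul0r.
have lin2 : (i <= i + n.+1)%N by lia.
have lin3 : (i + n.+1 <= n + n)%N by have := ltn_ord i; lia.
rewrite (big_cat_nat _ (n := (i + n.+1)%N)) //= [X in _ + X]big_nat_cond.
rewrite [X in _ + X]big1 ?addr0; last first.
  move=> j /andP[/andP[ij _] _]; have -> : (j <= i + n)%N = false by lia.
  by rewrite andbF mul0r.
rewrite -{1}(addn0 i) addnC big_addn addKn big_mkord; apply: eq_bigr => l _.
have -> : (i <= l + i <= i + n)%N by have := ltn_ord l; lia.
by rewrite addnK addnC.
Qed.

Lemma size_prod_ord (D : nzRingType) (n : nat) (al : 'I_n -> D) :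
  size (\prod_i ('X - (al i)%:P)) = n.+1.
Proof. by rewrite size_prod_XsubC /index_enum; unlock; rewrite -enumT size_enum_ord. Qed.

(* Multiplying the Sylvester matrix on the right by [[W, 0], [*, 1]], with W
   the Vandermonde matrix of the roots, makes it block anti-triangular. *)
Lemma hresultant_prod_distinct (D : idomainType) (n : nat) (c : D)
    (al : 'I_n -> D) (F R : nat -> D) :
  injective al ->
  (forall l, (l <= n)%N -> F l = (c *: \prod_i ('X - (al i)%:P))`_l) ->
  hresultant n F R =
    (-1) ^+ n * c ^+ n * \prod_i \sum_(l < n.+1) R l * al i ^+ l.
Proof.
move=> al_inj FE.
have sz : size (c *: \prod_i ('X - (al i)%:P) : {poly D}) = if c == 0 then 0%N else n.+1.
  case: eqP => [->|/eqP c0]; first by rewrite scale0r size_poly0.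
  by rewrite size_scale // size_prod_ord.
have Froot i : \sum_(l < n.+1) F l * al i ^+ l = 0.
  have -> : \sum_(l < n.+1) F l * al i ^+ l =
      (c *: \prod_i ('X - (al i)%:P)).[al i].
    rewrite (@horner_coef_wide _ n.+1) ?sz; last by case: ifP.
    by apply: eq_bigr => l _; rewrite FE // -ltnS.
  by rewrite hornerZ horner_prod (bigD1 i) //= hornerXsubC subrr mul0r mulr0.
have Flead : F n = c.
  rewrite FE // coefZ.
  have /monicP := monic_prod_XsubC (index_enum 'I_n) xpredT al.
  by rewrite lead_coefE size_prod_ord /= => ->; rewrite mulr1.
pose W : 'M[D]_n := \matrix_(i, j) al j ^+ i.
pose W' : 'M[D]_n := \matrix_(i, j) al j ^+ (n + i).
pose E : 'M[D]_n := \matrix_(i, j) (al j ^+ i * \sum_(l < n.+1) R l * al j ^+ l).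
have WE (s : nat -> D) : band n s *m col_mx W W' =
    \matrix_(i, j) (al j ^+ i * \sum_(l < n.+1) s l * al j ^+ l).
  apply/matrixP => i j; rewrite mxE [RHS]mxE.
  transitivity (\sum_(m < n + n) (band n s) i m * al j ^+ m).
    apply: eq_bigr => m _; congr (_ * _); rewrite mxE.
    by case: split_ordP => m' ->; rewrite mxE.
  rewrite (sum_band s (fun m => al j ^+ m)) mulr_sumr; apply: eq_bigr => l _.
  by rewrite exprD; ring.
pose B : 'M[D]_n := rsubmx (band n F).
pose DD : 'M[D]_n := rsubmx (band n R).
(* Distinctness of the roots makes the Vandermonde determinant nonzero, so that it can be cancelled
   below. *)
have detW : \det W != 0.
  have -> : W = Vandermonde n (\row_j al j).
    by apply/matrixP => i j; rewrite !mxE.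
  rewrite det_Vandermonde; apply/prodf_neq0 => i _; apply/prodf_neq0 => j ij.
  by rewrite !mxE subr_eq0 (inj_eq al_inj) -(inj_eq val_inj) gtn_eqF.
(* The right half of the band is lower triangular, with the leading coefficient [F n = c] along the
   diagonal. *)
have detB : \det B = c ^+ n.
  rewrite det_trig.
    under eq_bigr => i _ do
      rewrite !mxE /= leq_addl [X in (_ <= X)%N]addnC leqnn addnK Flead.
    by rewrite prodr_const card_ord.
  apply/is_trig_mxP => i j ij; rewrite !mxE /=.
  by have -> : (n + j <= i + n)%N = false; [lia | rewrite andbF].
have detE : \det E = \det W * \prod_j \sum_(l < n.+1) R l * al j ^+ l.
  have -> : E = W *m diag_mx (\row_j \sum_(l < n.+1) R l * al j ^+ l).
    by apply/matrixP => i j; rewrite mul_mx_diag !mxE.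
  by rewrite det_mulmx det_diag; congr (_ * _); apply: eq_bigr => j _; rewrite mxE.
apply: (mulIf detW); rewrite -[hresultant _ _ _]/(\det (col_mx (band n F) (band n R))).
have -> : \det W = \det (block_mx W 0 W' 1%:M) by rewrite det_lblock det1 mulr1.
rewrite -det_mulmx.
have -> : col_mx (band n F) (band n R) *m block_mx W 0 W' 1%:M = block_mx 0 B E DD.
  rewrite block_mxEh mul_mx_row mul_col_mx.
  rewrite WE WE mul_col_mx block_mxEh; congr (row_mx (col_mx _ _) (col_mx _ _)).
  - by apply/matrixP => i j; rewrite !mxE Froot mulr0.
  - by rewrite -{1}(hsubmxK (band n F)) mul_row_col mulmx0 add0r mulmx1.
  - by rewrite -{1}(hsubmxK (band n R)) mul_row_col mulmx0 add0r mulmx1.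
rewrite det_anti_block detB detE det_lblock det1 mulr1; ring.
Qed.

Lemma rmorph_hresultant (C C' : comNzRingType) (f : {rmorphism C -> C'}) (n : nat)
    (F R : nat -> C) :
  f (hresultant n F R) = hresultant n (f \o F) (f \o R).
Proof.
rewrite -det_map_mx map_col_mx; congr (\det (col_mx _ _));
by apply/matrixP => i j; rewrite !mxE; case: ifP => // _; rewrite rmorph0.
Qed.

(* The roots al i + i Y in D[Y] are distinct, and specialise at Y = 0. *)
Lemma hresultant_prod (D : idomainType) (n : nat) (c : D)
    (al : 'I_n -> D) (F R : nat -> D) :
  [pchar D] =i pred0 ->
  (forall l, (l <= n)%N -> F l = (c *: \prod_i ('X - (al i)%:P))`_l) ->
  hresultant n F R =
    (-1) ^+ n * c ^+ n * \prod_i \sum_(l < n.+1) R l * al i ^+ l.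
Proof.
move=> /pcharf0P ch FE.
pose be (i : 'I_n) : {poly D} := (al i)%:P + i%:R *: 'X.
pose F' l := (c%:P *: \prod_i ('X - (be i)%:P))`_l.
(* In characteristic zero the slopes [i%:R] are already pairwise distinct. *)
have be_inj : injective be.
  move=> i j /(congr1 (fun p : {poly D} => p`_1)).
  rewrite /be !coefD !coefC !coefZ !coefX /= !add0r !mulr1 => e.
  apply/val_inj/eqP; wlog ij : i j e / (i <= j)%N.
    by move=> h; case: (leqP i j) => [|/ltnW] ij; [|rewrite eq_sym]; apply: h.
  rewrite eqn_leq ij -subn_eq0 -ch natrB // e subrr eqxx //.
have be0 i : (be i).[0] = al i by rewrite hornerD hornerC hornerZ hornerX mulr0 addr0.
have := @hresultant_prod_distinct _ n c%:P be F' (polyC \o R) be_inj (fun _ _ => erefl).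
move=> /(congr1 (horner_eval 0)); rewrite rmorph_hresultant.
have -> : horner_eval 0 ((-1) ^+ n * c%:P ^+ n * \prod_i \sum_(l < n.+1)
    (polyC \o R) l * be i ^+ l) =
    (-1) ^+ n * c ^+ n * \prod_i \sum_(l < n.+1) R l * al i ^+ l.
  rewrite !rmorphM !rmorphXn rmorphN1 rmorph_prod /= {1}/horner_eval hornerC.
  congr (_ * _); apply: eq_bigr => i _; rewrite rmorph_sum; apply: eq_bigr => l _.
  by rewrite rmorphM rmorphXn /= /horner_eval hornerC be0.
move=> <-; congr (\det (col_mx _ _)); apply/matrixP => i j; rewrite !mxE;
  case: ifP => // /andP[h1 h2] /=; rewrite /horner_eval ?hornerC //.
rewrite FE; last by lia.
rewrite /F' -/(horner_eval 0 _) -coef_map; congr (_ `_ _).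
rewrite map_polyZ rmorph_prod /= {1}/horner_eval hornerC.
rewrite [in RHS](eq_bigr (fun m => 'X - (al m)%:P)) // => m _.
by rewrite rmorphB /= map_polyX map_polyC /= /horner_eval be0.
Qed.

(** * The quotient of the resultant by a_00 a_de *)

Section Coefficients.
Variables (C : comNzRingType) (d e : nat).
Implicit Types (a : 'M[C]_(d.+1, e.+1)) (l : nat).

Definition Fcoef a l : C :=
  \sum_(i < d.+1) \sum_(j < e.+1) (a i j *+ (i + j == l)%N).

(* The coefficients of e P - d Q, halved. *)
Definition Gcoef a l : C :=
  \sum_(i < d.+1) \sum_(j < e.+1)
     ((a i j *+ (i + j == l)%N) * ((e * i)%:R - (d * j)%:R)).

(** The Sylvester band of F with its first column divided by [Fcoef a 0] and its last by
    [Fcoef a (d + e)]. Within the band each of these columns meets a single row, where the entry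
    becomes 1. *)
Definition Ublock a : 'M[C]_(d + e, d + e + (d + e)) :=
  \matrix_(i, j) if (i <= j <= i + (d + e))%N then
    if (j == 0 :> nat) || (j == (d + e + (d + e)).-1 :> nat) then 1
    else Fcoef a (j - i) else 0.

(** The band of [z1 F_1 - z0 F_0], whose coefficients are [(2l - n) F_l] with [n = d + e], after the
    same division of the two outer columns. The outer columns of [Vblock1] are zero, since [Gcoef]
    vanishes at 0 and at [n]. *)
Definition Vblock0 a : 'M[C]_(d + e, d + e + (d + e)) :=
  \matrix_(i, j) ((((j - i).*2)%:R - (d + e)%:R) * Ublock a i j).

Definition Vblock1 a : 'M[C]_(d + e, d + e + (d + e)) := band (d + e) (Gcoef a).

(* The coefficient of dz0^(d+e-j) dz1^j in the quotient of the resultant by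
   a_00 a_de. *)
Definition tcoef a (j : nat) : C :=
  \sum_(S : {set 'I_(d + e)} | #|S| == j)
     \det (col_mx (Ublock a)
       (\matrix_(i, m) if i \in S then Vblock1 a i m else Vblock0 a i m)).

Lemma Fcoef0 a : Fcoef a 0 = a ord0 ord0.
Proof.
rewrite /Fcoef big_ord_recl big_ord_recl /= mulr1n.
rewrite big1 ?addr0 => [|j _]; last by rewrite mulr0n.
by rewrite big1 ?addr0 // => i _; rewrite big1 // => j _; rewrite mulr0n.
Qed.

Lemma Fcoef_max a : Fcoef a (d + e) = a ord_max ord_max.
Proof.
rewrite /Fcoef big_ord_recr big_ord_recr /= eqxx mulr1n.
rewrite [X in X + _]big1 => [|i _]; last first.
  rewrite big1 // => j _; have -> : (i + j == d + e)%N = false; last by rewrite mulr0n.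
  by have := ltn_ord i; have := ltn_ord j; lia.
rewrite add0r big1 ?add0r // => j _.
have -> : (d + j == d + e)%N = false by have := ltn_ord j; lia.
by rewrite mulr0n.
Qed.

Lemma Gcoef0 a : Gcoef a 0 = 0.
Proof.
rewrite /Gcoef big1 // => i _; rewrite big1 // => j _.
case: eqP; last by rewrite mulr0n mul0r.
move=> h; have [-> ->] : i = 0%N :> nat /\ j = 0%N :> nat by lia.
by rewrite !muln0 subrr mulr0.
Qed.

Lemma Gcoef_max a : Gcoef a (d + e) = 0.
Proof.
rewrite /Gcoef big1 // => i _; rewrite big1 // => j _.
case: eqP; last by rewrite mulr0n mul0r.
move=> h; have [-> ->] : i = d :> nat /\ j = e :> nat.
  by have := ltn_ord i; have := ltn_ord j; lia.
by rewrite mulnC subrr mulr0.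
Qed.

(** Multilinearity of the determinant in its last [q] rows; [S] is the set of rows in which the [V1]
    summand is chosen. *)
Lemma det_pencil p q (U : 'M[C]_(p, p + q)) (V0 V1 : 'M[C]_(q, p + q)) (x y : C) :
  \det (col_mx U (x *: V0 + y *: V1)) =
  \sum_(S : {set 'I_q}) x ^+ (q - #|S|) * y ^+ #|S| *
     \det (col_mx U (\matrix_(i, m) if i \in S then V1 i m else V0 i m)).
Proof.
under [RHS]eq_bigr do rewrite mulr_sumr.
rewrite exchange_big /=; apply: eq_bigr => s _.
rewrite big_split_ord /=.
rewrite [X in _ * (_ * X)](eq_bigr (fun i => y * V1 i (s (rshift p i)) + x * V0 i (s (rshift p i)))); last first.
  by move=> i _; rewrite col_mxEd !mxE addrC.
rewrite bigA_distr !mulr_sumr; apply: eq_bigr => S _.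
rewrite big_split_ord /=.
have -> : \prod_(i < p) (col_mx U (x *: V0 + y *: V1)) (lshift q i) (s (lshift q i)) =
   \prod_(i < p) U i (s (lshift q i)).
  by apply: eq_bigr => i _; rewrite col_mxEu.
have -> : \prod_(i < p) (col_mx U (\matrix_(i, m) (if i \in S then V1 i m else V0 i m)))
     (lshift q i) (s (lshift q i)) = \prod_(i < p) U i (s (lshift q i)).
  by apply: eq_bigr => i _; rewrite col_mxEu.
have -> : \prod_(i < q) (if i \in S then y * V1 i (s (rshift p i)) else x * V0 i (s (rshift p i)))
  = x ^+ (q - #|S|) * y ^+ #|S| * \prod_(i < q) (col_mx U (\matrix_(i, m) (if i \in S then V1 i m else V0 i m)))
     (rshift p i) (s (rshift p i)).
  rewrite (bigID (mem S)) /= [in RHS](bigID (mem S)) /=.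
  under eq_bigr => i iS do rewrite iS.
  rewrite big_split prodr_const /=.
  under [X in _ * X = _]eq_bigr => i iS do rewrite (negbTE iS).
  rewrite big_split prodr_const /=.
  under [X in _ = _ * (X * _)]eq_bigr => i iS do rewrite col_mxEd mxE iS.
  under [X in _ = _ * (_ * X)]eq_bigr => i iS do rewrite col_mxEd mxE (negbTE iS).
  have -> : #|[pred i | i \notin S]| = (q - #|S|)%N.
    have := cardC (mem S); rewrite card_ord => cC.
    by apply/eqP; rewrite -(eqn_add2l #|S|) cC subnKC // -[X in (_ <= X)%N]card_ord max_card.
  by ring.
by rewrite [RHS]mulrCA; congr (_ * _); rewrite mulrCA.
Qed.

Lemma tcoef_sum a (x y : C) :
  \sum_(j < (d + e).+1) tcoef a j * (x ^+ (d + e - j) * y ^+ j) =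
  \det (col_mx (Ublock a) (x *: Vblock0 a + y *: Vblock1 a)).
Proof.
rewrite det_pencil (partition_big (fun S : {set 'I_(d + e)} => inord #|S| : 'I_(d + e).+1) xpredT) //=.
apply: eq_bigr => j _; rewrite mulr_suml; apply: eq_big => S.
  rewrite -val_eqE /= inordK // ltnS; apply: leq_trans (max_card _) _.
  by rewrite card_ord.
by move=> /eqP ->; rewrite mulrC.
Qed.

(** The Sylvester matrix is the matrix with divided outer columns times the diagonal matrix [D],
    which carries [Fcoef a 0] and [Fcoef a (d + e)] in its first and last place and 1 elsewhere. No
    division takes place, so the identity holds over any commutative ring. *)
Lemma sylvester_factor a (x y : C) : (0 < d + e)%N ->
  hresultant (d + e) (Fcoef a)
     (fun l => x * (((l.*2)%:R - (d + e)%:R) * Fcoef a l) + y * Gcoef a l) =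
  Fcoef a 0 * Fcoef a (d + e) *
     \sum_(j < (d + e).+1) tcoef a j * (x ^+ (d + e - j) * y ^+ j).
Proof.
rewrite tcoef_sum; set n := (d + e)%N => n0.
pose D : 'rV[C]_(n + n) := \row_j
  (if j == 0 :> nat then Fcoef a 0 else if j == (n + n).-1 :> nat then Fcoef a n else 1).
rewrite mulrC; transitivity (\det (col_mx (Ublock a) (x *: Vblock0 a + y *: Vblock1 a)) * \det (diag_mx D)).
  rewrite -det_mulmx mul_col_mx; congr (\det (col_mx _ _)).
    apply/matrixP => i j; rewrite mul_mx_diag !mxE -/n.
    case: ifP => [/andP[h1 h2]|_]; last by rewrite mul0r.
    case: (eqVneq (j : nat) 0%N) h1 h2 => [-> h1 h2|j0 h1 h2] /=.
      by rewrite mul1r sub0n.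
    case: eqP => [jn|_]; last by rewrite mulr1.
    by rewrite mul1r; congr (Fcoef a); have := ltn_ord i; lia.
  apply/matrixP => i j; rewrite mul_mx_diag !mxE -/n.
  case: ifP => [/andP[h1 h2]|_]; last by rewrite !mulr0 addr0 mul0r.
  case: (eqVneq (j : nat) 0%N) h1 h2 => [-> h1 h2|j0 h1 h2] /=.
    by rewrite !sub0n Gcoef0; ring.
  case: eqP => [jn|_]; last by rewrite mulr1.
  have -> : (j - i)%N = n by have := ltn_ord i; lia.
  by rewrite Gcoef_max; ring.
rewrite det_diag; congr (_ * _).
have i0 : (0 < n + n)%N by lia.
have in1 : ((n + n).-1 < n + n)%N by lia.
rewrite (bigD1 (Ordinal i0)) // (bigD1 (Ordinal in1)) /=; last by rewrite -val_eqE /=; lia.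
rewrite !mxE /= big1 ?mulr1.
  case: eqP => [|_]; [lia | by rewrite eqxx].
move=> i /andP[]; rewrite -!val_eqE /= => h1 h2.
by rewrite mxE (negbTE h1) (negbTE h2).
Qed.

End Coefficients.

Lemma Fcoef_map (C C' : comNzRingType) (f : {rmorphism C -> C'}) d e
    (a : 'M[C]_(d.+1, e.+1)) l : f (Fcoef a l) = Fcoef (map_mx f a) l.
Proof.
rewrite /Fcoef rmorph_sum; apply: eq_bigr => i _.
by rewrite rmorph_sum; apply: eq_bigr => j _; rewrite rmorphMn mxE.
Qed.

Lemma Gcoef_map (C C' : comNzRingType) (f : {rmorphism C -> C'}) d e
    (a : 'M[C]_(d.+1, e.+1)) l : f (Gcoef a l) = Gcoef (map_mx f a) l.
Proof.
rewrite /Gcoef rmorph_sum; apply: eq_bigr => i _; rewrite rmorph_sum.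
by apply: eq_bigr => j _; rewrite rmorphM rmorphMn rmorphB !rmorph_nat mxE.
Qed.

Lemma tcoef_map (C C' : comNzRingType) (f : {rmorphism C -> C'}) d e
    (a : 'M[C]_(d.+1, e.+1)) j : f (tcoef a j) = tcoef (map_mx f a) j.
Proof.
have UE i m : f (Ublock a i m) = Ublock (map_mx f a) i m.
  rewrite !mxE; case: ifP => _; last by rewrite rmorph0.
  by case: ifP => _; rewrite ?rmorph1 ?Fcoef_map.
rewrite /tcoef rmorph_sum; apply: eq_bigr => S _.
rewrite -det_map_mx map_col_mx; congr (\det (col_mx _ _)).
  by apply/matrixP => i m; rewrite mxE.
apply/matrixP => i m; rewrite [LHS]mxE [X in f X]mxE [RHS]mxE; case: ifP => _.
  by rewrite !mxE; case: ifP => _; rewrite ?rmorph0 ?Gcoef_map.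
by rewrite [X in f X]mxE [RHS]mxE rmorphM rmorphB !rmorph_nat UE.
Qed.

(** * Coefficients of F, P and Q, and the resultant in terms of dz0 and dz1 *)

Lemma mpolyX2 (C : nzRingType) (u v : nat) :
  'X_[[multinom [tuple u; v]]] = 'X_(inord 0) ^+ u * 'X_(inord 1) ^+ v :> {mpoly C[2]}.
Proof.
rewrite mpolyXE_id 2!big_ord_recl big_ord0 mulr1 !multinomE /=.
have -> : inord 0 = ord0 :> 'I_2 by apply: val_inj; rewrite /= inordK.
by have -> : inord 1 = lift ord0 ord0 :> 'I_2 by apply: val_inj; rewrite /= inordK.
Qed.

Lemma mpolyX4 (C : nzRingType) (u v w t : nat) :
  'X_[[multinom [tuple u; v; w; t]]] = 'X_(inord 0) ^+ u * 'X_(inord 1) ^+ v *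
     'X_(inord 2) ^+ w * 'X_(inord 3) ^+ t :> {mpoly C[4]}.
Proof.
have -> : inord 0 = ord0 :> 'I_4 by apply: val_inj; rewrite /= inordK.
have -> : inord 1 = lift ord0 ord0 :> 'I_4 by apply: val_inj; rewrite /= inordK.
have -> : inord 2 = lift ord0 (lift ord0 ord0) :> 'I_4.
  by apply: val_inj; rewrite /= inordK.
have -> : inord 3 = lift ord0 (lift ord0 (lift ord0 ord0)) :> 'I_4.
  by apply: val_inj; rewrite /= inordK.
by rewrite mpolyXE_id 4!big_ord_recl big_ord0 mulr1 !multinomE /= !mulrA.
Qed.

Lemma mulX_mderivX (C : comNzRingType) (n : nat) (i : 'I_n) (m : 'X_{1..n}) :
  'X_i * ('X_[m])^`M(i) = (m i)%:R *: 'X_[m] :> {mpoly C[n]}.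
Proof.
rewrite mderivX -scalerAr; case: (posnP (m i)) => [->|mi]; first by rewrite !scale0r.
by rewrite -mpolyXD addmC submK // lep1mP -lt0n.
Qed.

Section Coordinates.
Variables (C : comNzRingType) (d e : nat).
Implicit Types a : 'M[C]_(d.+1, e.+1).

Lemma corr_formE a : corr_form a = \sum_(i < d.+1) \sum_(j < e.+1)
  a i j *: 'X_[[multinom [tuple (d - i)%N; i : nat; (e - j)%N; j : nat]]].
Proof. by apply: eq_bigr => i _; apply: eq_bigr => j _; rewrite mpolyX4. Qed.

Lemma bcoef_diag (w : 'I_d.+1 -> 'I_e.+1 -> C) (l : nat) : (l <= d + e)%N ->
  bcoef (d + e) (diag (\sum_i \sum_j
     w i j *: 'X_[[multinom [tuple (d - i)%N; i : nat; (e - j)%N; j : nat]]])) l =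
  \sum_i \sum_j (w i j *+ (i + j == l)%N).
Proof.
move=> ln; rewrite /bcoef /diag (raddf_sum (comp_mpoly _)) (raddf_sum (mcoeff _)).
apply: eq_bigr => i _.
rewrite (raddf_sum (comp_mpoly _)) (raddf_sum (mcoeff _)).
apply: eq_bigr => j _ /=.
rewrite comp_mpolyZ mpolyX4 !rmorphM !rmorphXn /= !comp_mpolyXU !inordK //=.
have -> : 'X_(inord 0) ^+ (d - i) * 'X_(inord 1) ^+ i * 'X_(inord 0) ^+ (e - j) *
    'X_(inord 1) ^+ j = 'X_[[multinom [tuple (d - i + (e - j))%N; (i + j)%N]]] :> {mpoly C[2]}.
  by rewrite mpolyX2 !exprD; ring.
rewrite mcoeffZ mcoeffX mulr_natr; congr (_ *+ nat_of_bool _).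
apply/eqP/eqP => [/mnmP/(_ (inord 1))|<-]; first by rewrite !multinomE !(tnth_nth 0%N) /= inordK.
apply/mnmP; case=> [[|[|//]] h]; rewrite !multinomE !(tnth_nth 0%N) //=.
by have := ltn_ord i; have := ltn_ord j; lia.
Qed.

Lemma bcoef_fix_form a l : (l <= d + e)%N -> bcoef (d + e) (fix_form a) l = Fcoef a l.
Proof. by move=> ln; rewrite /fix_form corr_formE bcoef_diag. Qed.

Let weight_form a (r0 r1 : 'I_4) :
  'X_r1 * (corr_form a)^`M(r1) - 'X_r0 * (corr_form a)^`M(r0) =
  \sum_i \sum_j (a i j * ((tnth [tuple (d - i)%N; i : nat; (e - j)%N; j : nat] r1)%:R
     - (tnth [tuple (d - i)%N; i : nat; (e - j)%N; j : nat] r0)%:R)) *: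
     'X_[[multinom [tuple (d - i)%N; i : nat; (e - j)%N; j : nat]]].
Proof.
rewrite corr_formE !raddf_sum /= !mulr_sumr -sumrB; apply: eq_bigr => i _.
rewrite !raddf_sum /= !mulr_sumr -sumrB; apply: eq_bigr => j _.
rewrite !mderivZ -!scalerAr !mulX_mderivX -!scalerBr -scalerBl scalerA.
by rewrite !multinomE.
Qed.

Lemma bcoef_P_form a l : (l <= d + e)%N -> bcoef (d + e) (P_form a) l =
  \sum_i \sum_j ((a i j *+ (i + j == l)%N) * (i%:R - (d - i)%:R)).
Proof.
move=> ln; rewrite /P_form /= weight_form bcoef_diag //.
apply: eq_bigr => i _; apply: eq_bigr => j _.
by rewrite !(tnth_nth 0%N) /= !inordK //= -mulrnAl.
Qed.

Lemma bcoef_Q_form a l : (l <= d + e)%N -> bcoef (d + e) (Q_form a) l =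
  \sum_i \sum_j ((a i j *+ (i + j == l)%N) * (j%:R - (e - j)%:R)).
Proof.
move=> ln; rewrite /Q_form /= weight_form bcoef_diag //.
apply: eq_bigr => i _; apply: eq_bigr => j _.
by rewrite !(tnth_nth 0%N) /= !inordK //= -mulrnAl.
Qed.

(** On the antidiagonal [i + j = l] the weights [2i - d] and [2j - e] add up to [2l - (d + e)]. *)
Lemma bcoef_PQ_sum a l : (l <= d + e)%N ->
  bcoef (d + e) (P_form a) l + bcoef (d + e) (Q_form a) l =
  ((l.*2)%:R - (d + e)%:R) * Fcoef a l.
Proof.
move=> ln; rewrite bcoef_P_form // bcoef_Q_form // /Fcoef mulr_sumr -big_split /=.
apply: eq_bigr => i _; rewrite mulr_sumr -big_split /=; apply: eq_bigr => j _.
have [<-|_] := eqVneq (i + j)%N l; last by rewrite !mulr0n; ring.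
rewrite !natrB -1?ltnS // -muln2 natrM !natrD; ring.
Qed.

(** The constant terms cancel in [e (2i - d) - d (2j - e) = 2 (e i - d j)]. *)
Lemma bcoef_PQ_diff a l : (l <= d + e)%N ->
  e%:R * bcoef (d + e) (P_form a) l - d%:R * bcoef (d + e) (Q_form a) l =
  2%:R * Gcoef a l.
Proof.
move=> ln; rewrite bcoef_P_form // bcoef_Q_form // /Gcoef !mulr_sumr -sumrB /=.
apply: eq_bigr => i _; rewrite !mulr_sumr -sumrB /=; apply: eq_bigr => j _.
rewrite !natrB -1?ltnS // !natrM; ring.
Qed.

End Coordinates.

Lemma dhomog_bigprod (R : comNzRingType) (N : nat) (I : Type) (r : seq I)
    (F : I -> {mpoly R[N]}) (w : I -> nat) :
  (forall i, F i \is (w i).-homog) ->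
  \prod_(i <- r) F i \is (\sum_(i <- r) w i)%N.-homog.
Proof.
move=> Fw; elim: r => [|i r IH]; first by rewrite !big_nil dhomog1.
by rewrite !big_cons dhomogM.
Qed.

(** Each term of the Leibniz expansion takes exactly one entry from every column. *)
Lemma dhomog_det (R : comNzRingType) (N n : nat) (M : 'M[{mpoly R[N]}]_n) (w : 'I_n -> nat) :
  (forall i j, M i j \is (w j).-homog) -> \det M \is (\sum_j w j)%N.-homog.
Proof.
move=> Mw; apply: rpred_sum => s _.
have -> : (\sum_j w j = \sum_j w (s j))%N by rewrite (reindex_inj (@perm_inj _ s)).
by rewrite mulr_sign; case: ifP => _; rewrite ?rpredN; apply: dhomog_bigprod.
Qed.

Lemma eq_hresultant (C : comNzRingType) (n : nat) (F F' R R' : nat -> C) :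
  (forall l, (l <= n)%N -> F l = F' l) -> (forall l, (l <= n)%N -> R l = R' l) ->
  hresultant n F R = hresultant n F' R'.
Proof.
move=> eF eR; congr (\det (col_mx _ _)); apply/matrixP => i j; rewrite !mxE;
by case: ifP => // /andP[h1 h2]; rewrite ?eF ?eR // leq_subLR.
Qed.

(** The change of basis from dx, dy to dz0, dz1 for one coefficient of [P dx + Q dy]: [c] is the
    inverse of [d + e], [f] comes from [P + Q] and [g] from [(e P - d Q) / 2]. *)
Lemma pencil_coords (S : comNzRingType) (c dd ee x0 x1 p q f g : S) :
  c * (dd + ee) = 1 -> p + q = f -> ee * p - dd * q = 2%:R * g ->
  p * x0 + q * x1 = c * (dd * x0 + ee * x1) * f + c * 2%:R * (x0 - x1) * g.
Proof.
move=> cN <- eg.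
transitivity (c * (dd * x0 + ee * x1) * (p + q) + c * (x0 - x1) * (2%:R * g)); last by ring.
by rewrite -eg -[LHS]mul1r -cN; ring.
Qed.

(** With [h = 1/2], the values [dx = 1 + e h x] and [dy = 1 - d h x] solve [dz0 = 1], [dz1 = x]; the
    next lemma is the second equation. *)
Lemma dual_coord0 (S : comNzRingType) (c dd ee h x : S) : c * (dd + ee) = 1 ->
  c * (dd * (1 + ee * h * x) + ee * (1 - dd * h * x)) = 1.
Proof. by move=> cN; rewrite -[RHS]cN; ring. Qed.

Lemma dual_coord1 (S : comNzRingType) (c dd ee h x : S) : c * (dd + ee) = 1 ->
  h * 2%:R = 1 -> c * 2%:R * ((1 + ee * h * x) - (1 - dd * h * x)) = x.
Proof.
move=> cN h2; transitivity (c * (dd + ee) * (h * 2%:R) * x); first by ring.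
by rewrite cN h2 !mul1r.
Qed.

Lemma multiplier_res_pencil (C : comNzRingType) (d e : nat) (a : 'M[C]_(d.+1, e.+1))
    (c : {mpoly C[2]}) : (0 < d)%N -> c * (d%:R + e%:R) = 1 ->
  multiplier_res a = (Fcoef a 0 * Fcoef a (d + e)) *:
    \sum_(j < (d + e).+1) tcoef a j *:
       ((c * (d%:R * 'X_(inord 0) + e%:R * 'X_(inord 1))) ^+ (d + e - j) *
        (c * 2%:R * ('X_(inord 0) - 'X_(inord 1))) ^+ j).
Proof.
move=> d0 cN; set x := c * (_ + _); set y := c * 2%:R * _.
set a' := map_mx (@mpolyC 2 C) a.
rewrite /multiplier_res.
rewrite (@eq_hresultant _ _ _ (Fcoef a') _
  (fun l => x * (((l.*2)%:R - (d + e)%:R) * Fcoef a' l) + y * Gcoef a' l)).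
- rewrite sylvester_factor ?addn_gt0 ?d0 // -!Fcoef_map -mpolyCM mul_mpolyC.
  by congr (_ *: _); apply: eq_bigr => j _; rewrite -tcoef_map mul_mpolyC.
- by move=> l ln; rewrite bcoef_fix_form // -Fcoef_map.
move=> l ln; rewrite -!mul_mpolyC -(Fcoef_map (@mpolyC 2 C) a) -(Gcoef_map (@mpolyC 2 C) a).
rewrite /x /y; apply: pencil_coords => //.
  by rewrite -(rmorphD (@mpolyC 2 C)) bcoef_PQ_sum // rmorphM rmorphB !rmorph_nat.
rewrite -!(rmorph_nat (@mpolyC 2 C)) -!(rmorphM (@mpolyC 2 C)) -(rmorphB (@mpolyC 2 C)).
by rewrite bcoef_PQ_diff.
Qed.

(** * The generic form: degree and coordinates of the quotient *)

Section Generic.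
Variables (k : fieldType) (d e : nat).
Hypothesis k0 : [pchar k] =i pred0.
Hypotheses (d_gt0 : (0 < d)%N) (e_gt0 : (0 < e)%N).

Local Notation A := (corr_ring k d e).
Local Notation gen := (generic_corr k d e).
Local Notation iota := (map_mpoly (n := 2) (@mpolyC (d.+1 * e.+1) k)).

Definition tcoefs : (d + e).+1.-tuple A := [tuple tcoef gen j | j < (d + e).+1].

Let natk_neq0 (m : nat) : (0 < m)%N -> m%:R != 0 :> k.
Proof. by move/pcharf0P: k0 => -> ; rewrite lt0n. Qed.

Lemma dz_morph (S : comNzRingType) (f : {rmorphism {mpoly k[2]} -> S}) :
  exists2 c : S, c * (d + e)%:R = 1 &
    f (dz0 k d e) = c * (d%:R * f 'X_(inord 0) + e%:R * f 'X_(inord 1)) /\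
    f (dz1 k d e) = c * 2%:R * (f 'X_(inord 0) - f 'X_(inord 1)).
Proof.
have fn m : f m%:R%:MP = m%:R by rewrite !rmorph_nat.
exists (f ((d + e)%:R^-1)%:MP).
  rewrite -fn -rmorphM /= -mpolyCM mulVf ?rmorph1 //.
  by rewrite natk_neq0 // addn_gt0 d_gt0.
rewrite /dz0 /dz1 -!mul_mpolyC !mpolyCM !(rmorphD, rmorphB, rmorphM) /= !fn.
by split; ring.
Qed.

Lemma multiplier_resE :
  multiplier_res gen = (Fcoef gen 0 * Fcoef gen (d + e)) *: D_elt tcoefs.
Proof.
have [c cN [xE yE]] := dz_morph iota.
rewrite natrD in cN; rewrite (multiplier_res_pencil _ d_gt0 cN); congr (_ *: _).
apply: eq_bigr => j _; rewrite tnth_mktuple rmorphM !rmorphXn /= xE yE /=.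
by rewrite !map_mpolyX.
Qed.

Lemma dhomog_gen i j : gen i j \is 1.-homog.
Proof. by rewrite mxE dhomogX /= mdeg1. Qed.

Lemma dhomog_Fcoef l : Fcoef gen l \is 1.-homog.
Proof.
by apply: rpred_sum => i _; apply: rpred_sum => j _; rewrite rpredMn // dhomog_gen.
Qed.

Lemma dhomog_Gcoef l : Gcoef gen l \is 1.-homog.
Proof.
apply: rpred_sum => i _; apply: rpred_sum => j _.
by rewrite mulrBr !mulr_natr rpredB // rpredMn // rpredMn // dhomog_gen.
Qed.

(** Of the [2 (d + e)] columns, the two outer ones have constant entries after the division and all
    others have linear entries, so the degree is [2 (d + e) - 2]. *)
Lemma dhomog_tcoefs j : tnth tcoefs j \is ((d + e).-1.*2).-homog.
Proof.
have n0 : (0 < d + e)%N by rewrite addn_gt0 d_gt0.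
rewrite tnth_mktuple; apply: rpred_sum => S _.
pose edge (m : nat) := (m == 0%N) || (m == (d + e + (d + e)).-1).
have <- : (\sum_(m < d + e + (d + e)) ~~ edge m = (d + e).-1.*2)%N.
  rewrite -(big_mkord xpredT (fun m => (~~ edge m : nat))).
  set n := (d + e)%N in n0 edge *.
  have -> : (n + n = (n.-1.*2).+2)%N by lia.
  rewrite big_nat_recl // big_nat_recr //= /edge /=.
  have -> : ((n.-1.*2).+1 == (n + n).-1)%N by apply/eqP; lia.
  rewrite add0n addn0 -[RHS]muln1 -[X in (X * 1)%N]subn0 -sum_nat_const_nat.
  by rewrite !big_nat; apply: eq_bigr => m /andP[_ h]; have -> : (m.+1 == (n + n).-1)%N = false by lia.
have UH i m : Ublock gen i m \is (~~ edge m : nat).-homog.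
  rewrite mxE; case: ifP => _; last exact: rpred0.
  by rewrite -/(edge m); case: (edge m); rewrite ?dhomog1 ?dhomog_Fcoef.
apply: dhomog_det => i m; rewrite mxE; case: splitP => i' _ //; rewrite mxE.
case: ifP => _; last by rewrite mxE mulrBl !mulr_natl rpredB // rpredMn.
(* In an outer column an entry of [Vblock1] is an extreme [Gcoef], hence zero, and zero is
   homogeneous of degree 0 too. *)
rewrite mxE; case: ifP => [/andP[h1 h2]|_]; last exact: rpred0.
case: (boolP (edge m)) => [/orP[/eqP m0|/eqP mN]|_]; last exact: dhomog_Gcoef.
  by have -> : (m - i' = 0)%N; [lia | rewrite Gcoef0 rpred0].
have -> : (m - i' = d + e)%N by have := ltn_ord i'; lia.
by rewrite Gcoef_max rpred0.
Qed.

(** The substitution that sends dz0 to 1 and dz1 to ['X]: it turns the coordinates of a form in the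
    basis of monomials in dz0, dz1 into the coefficients of a polynomial. *)
Definition D_coord : {mpoly A[2]} -> {poly A} :=
  mmap polyC (fun i => if i == inord 0 then 1 + ((e%:R / 2%:R)%:MP)%:P * 'X
                       else 1 - ((d%:R / 2%:R)%:MP)%:P * 'X).

Lemma D_coord_elt (t : (d + e).+1.-tuple A) (u : A) (j : 'I_(d + e).+1) :
  (D_coord (u *: D_elt t))`_j = u * tnth t j.
Proof.
pose h (i : 'I_2) : {poly A} := if i == inord 0 then 1 + ((e%:R / 2%:R)%:MP)%:P * 'X
                       else 1 - ((d%:R / 2%:R)%:MP)%:P * 'X.
rewrite /D_coord -/h.
pose f : {rmorphism {mpoly k[2]} -> {poly A}} := mmap polyC h \o iota.
have [c cN [ez0 ez1]] := dz_morph f.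
have fX i : f 'X_i = h i by rewrite /= map_mpolyX mmapX mmap1U.
pose hf : {poly A} := ((2%:R^-1)%:MP)%:P.
have hf2 : hf * 2%:R = 1.
  rewrite /hf -[X in _ * X](rmorph_nat (polyC \o @mpolyC (d.+1 * e.+1) k)) /=.
  by rewrite -!rmorphM /= mulVf ?rmorph1 // natk_neq0.
have h0 : h (inord 0) = 1 + e%:R * hf * 'X.
  by rewrite /h eqxx !rmorphM /= !rmorph_nat.
have h1 : h (inord 1) = 1 - d%:R * hf * 'X.
  by rewrite /h -val_eqE /= !inordK //= !rmorphM /= !rmorph_nat.
rewrite !fX h0 h1 in ez0 ez1.
rewrite natrD in cN.
have {}ez0 : f (dz0 k d e) = 1 by rewrite ez0; apply: dual_coord0.
have {}ez1 : f (dz1 k d e) = 'X by rewrite ez1; apply: dual_coord1.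
rewrite mmapZ /D_elt raddf_sum /= coefCM; congr (_ * _).
under eq_bigr do rewrite mmapZ -[mmap _ _ _]/(f _) rmorphM !rmorphXn ez0 ez1 expr1n mul1r mul_polyC.
rewrite coef_sum (bigD1 j) //= coefZ coefXn eqxx mulr1 big1 ?addr0 // => i.
by rewrite -(inj_eq val_inj) eq_sym => /negbTE ij; rewrite coefZ coefXn ij mulr0.
Qed.

End Generic.

(** * The quotient as a product over the roots of F *)

Definition hom_eval (C : comNzRingType) (n : nat) (p : nat -> C) (z0 z1 : C) : C :=
  \sum_(l < n.+1) p l * (z0 ^+ (n - l) * z1 ^+ l).

Definition Fpoly (C : comNzRingType) d e (a : 'M[C]_(d.+1, e.+1)) : {poly C} :=
  \poly_(l < (d + e).+1) Fcoef a l.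

(* G = z0 z1 H *)
Definition Hpoly (C : comNzRingType) d e (a : 'M[C]_(d.+1, e.+1)) : {poly C} :=
  \poly_(l < (d + e).-1) Gcoef a l.+1.

Lemma Gcoef_Hpoly (C : comNzRingType) d e (a : 'M[C]_(d.+1, e.+1)) (x : C) :
  (1 < d + e)%N ->
  \sum_(l < (d + e).+1) Gcoef a l * x ^+ l = x * (Hpoly a).[x].
Proof.
move=> n1; have nE : (d + e = (d + e).-1.+1)%N by lia.
rewrite -(big_mkord xpredT (fun l => Gcoef a l * x ^+ l)) [in LHS]nE.
rewrite big_nat_recl // big_nat_recr //= -nE Gcoef0 Gcoef_max !mul0r add0r addr0.
rewrite big_mkord horner_poly mulr_sumr; apply: eq_bigr => l _.
by rewrite exprS mulrCA.
Qed.

Lemma Fpoly_coef (C : comNzRingType) d e (a : 'M[C]_(d.+1, e.+1)) l :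
  (l <= d + e)%N -> (Fpoly a)`_l = Fcoef a l.
Proof. by move=> ln; rewrite coef_poly ltnS ln. Qed.

Lemma deriv_prod_root (L : comNzRingType) (n : nat) (c : L) (al : 'I_n -> L) (i : 'I_n) :
  (c *: \prod_j ('X - (al j)%:P))^`().[al i] = c * \prod_(j | j != i) (al i - al j).
Proof.
rewrite derivZ hornerZ (bigD1 i) //= derivM derivXsubC hornerD !hornerM.
rewrite hornerXsubC subrr mul0r addr0 hornerC mul1r horner_prod; congr (_ * _).
by apply: eq_bigr => j _; rewrite hornerXsubC.
Qed.

(* As P + Q = z1 F_1 - z0 F_0, at a root of F the pencil is
   al_i (2 F'(al_i) X + H(al_i)). *)
Lemma tcoef_roots (L : fieldType) d e (a : 'M[L]_(d.+1, e.+1)) (c : L)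
    (al : 'I_(d + e) -> L) :
  [pchar L] =i pred0 -> (1 < d + e)%N -> c != 0 -> (forall i, al i != 0) ->
  Fpoly a = c *: \prod_i ('X - (al i)%:P) ->
  \sum_(j < (d + e).+1) (tcoef a j)%:P * 'X^(d + e - j) =
  (c ^+ (d + e - 2))%:P *
    \prod_i ((2%:R * (Fpoly a)^`().[al i])%:P * 'X + ((Hpoly a).[al i])%:P) :> {poly L}.
Proof.
move=> L0 n1 c0 al0 FE.
have Fl l : (l <= d + e)%N -> (Fpoly a)`_l = Fcoef a l by exact: Fpoly_coef.
have F0E : Fcoef a 0 = c * (-1) ^+ (d + e) * \prod_i al i.
  rewrite -Fl // -horner_coef0 FE hornerZ horner_prod -mulrA; congr (_ * _).
  rewrite -[X in _ ^+ X]card_ord -prodrN; apply: eq_bigr => i _.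
  by rewrite hornerXsubC sub0r.
have FnE : Fcoef a (d + e) = c.
  rewrite -Fl // FE coefZ.
  have /monicP := monic_prod_XsubC (index_enum 'I_(d + e)) xpredT al.
  by rewrite lead_coefE size_prod_ord /= => ->; rewrite mulr1.
have PL0 : [pchar {poly L}] =i pred0.
  move=> p; rewrite -(L0 p) !inE; congr (_ && _).
  by rewrite -(rmorph_nat (@polyC L)) polyC_eq0.
pose a' := map_mx (@polyC L) a.
(* The formula for the resultant is applied over [L[X]], with dz0 replaced by ['X] and dz1 by 1. *)
have main := @hresultant_prod {poly L} (d + e) c%:P (fun i => (al i)%:P) (Fcoef a')
   (fun l => 'X * (((l.*2)%:R - (d + e)%:R) * Fcoef a' l) + 1 * Gcoef a' l) PL0.
rewrite sylvester_factor in main; last by lia.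
have {}main := main _.
have Feval i : \sum_(l < (d + e).+1) Fcoef a l * al i ^+ l = 0.
  transitivity (Fpoly a).[al i]; first by rewrite horner_poly.
  by rewrite FE hornerZ horner_prod (bigD1 i) //= hornerXsubC subrr mul0r mulr0.
have Fder i : \sum_(l < (d + e).+1) (Fcoef a l *+ l) * al i ^+ l = al i * (Fpoly a)^`().[al i].
  rewrite (@horner_coef_wide _ (d + e)); last first.
    rewrite -ltnS; apply: leq_trans (lt_size_deriv _) (size_poly _ _).
    by rewrite -/(Fpoly a) FE scaler_eq0 negb_or c0 -size_poly_eq0 size_prod_ord.
  rewrite big_ord_recl mulr0n mul0r add0r mulr_sumr; apply: eq_bigr => l _.
  by rewrite coef_deriv Fl ?ltn_ord // lift0 exprS mulrCA.
have termE i : \sum_(l < (d + e).+1) ('X * (((l.*2)%:R - (d + e)%:R) * Fcoef a' l) +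
    1 * Gcoef a' l) * (al i)%:P ^+ l =
   (al i)%:P * ((2%:R * (Fpoly a)^`().[al i])%:P * 'X + ((Hpoly a).[al i])%:P).
  transitivity ('X * ((\sum_(l < (d + e).+1) (Fcoef a l *+ l) * al i ^+ l)%:P * 2%:R
     - (d + e)%:R * (\sum_(l < (d + e).+1) Fcoef a l * al i ^+ l)%:P)
     + (\sum_(l < (d + e).+1) Gcoef a l * al i ^+ l)%:P).
    rewrite !rmorph_sum mulr_suml mulr_sumr -sumrB mulr_sumr -big_split /=.
    apply: eq_bigr => l _; rewrite !rmorphM !rmorphXn rmorphMn /= -Fcoef_map -Gcoef_map.
    by rewrite -muln2 natrM -(mulr_natr (polyC _) l); ring.
  by rewrite Fder Feval Gcoef_Hpoly // rmorph0 !rmorphM rmorph_nat; ring.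
have lhsE : \sum_(j < (d + e).+1) tcoef a' j * ('X ^+ (d + e - j) * 1 ^+ j) =
   \sum_(j < (d + e).+1) (tcoef a j)%:P * 'X^(d + e - j).
  by apply: eq_bigr => j _; rewrite expr1n mulr1 -tcoef_map.
rewrite lhsE (eq_bigr _ (fun i _ => termE i)) big_split /= in main.
rewrite -!Fcoef_map F0E FnE -rmorph_prod /= in main.
(* By Vieta this constant is [a_00 a_de]. It absorbs the sign, the factors [al i] and two of the
   [d + e] powers of [c]. *)
have nz : (c * (-1) ^+ (d + e) * \prod_i al i)%:P * c%:P != 0 :> {poly L}.
  rewrite mulf_neq0 // polyC_eq0 // !mulf_neq0 ?expf_neq0 ?oppr_eq0 ?oner_neq0 //.
  by apply/prodf_neq0.
apply: (mulfI nz); rewrite main.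
  have cE : c ^+ (d + e) = c * (c * c ^+ (d + e - 2)).
    by rewrite -!exprS; congr (_ ^+ _); lia.
  have sE : (-1) ^+ (d + e) = ((-1) ^+ (d + e))%:P :> {poly L}.
    by rewrite rmorphXn rmorphN1.
  rewrite sE -(rmorphXn (@polyC L)) cE !(rmorphM (@polyC L)).
  have ar (s u q w x : {poly L}) : s * (u * (u * q)) * (w * x) = u * s * w * u * (q * x).
    by ring.
  exact: ar.
move=> l ln; rewrite -Fcoef_map -Fl // FE -(coef_map (@polyC L)) map_polyZ rmorph_prod /=.
rewrite [in LHS](eq_bigr (fun i => 'X - ((al i)%:P)%:P)) // => i _.
by rewrite rmorphB /= map_polyX map_polyC.
Qed.

(** * Invariance under SL_2 *)

Definition fev (C : comNzRingType) d e (a : 'M[C]_(d.+1, e.+1)) (x0 x1 y0 y1 : C) : C :=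
  \sum_(i < d.+1) \sum_(j < e.+1)
     a i j * (x0 ^+ (d - i) * x1 ^+ i * y0 ^+ (e - j) * y1 ^+ j).

Lemma meval_corr_form (C : comNzRingType) d e (a : 'M[C]_(d.+1, e.+1)) (h : 'I_4 -> C) :
  (corr_form a).@[h] = fev a (h (inord 0)) (h (inord 1)) (h (inord 2)) (h (inord 3)).
Proof.
rewrite /corr_form raddf_sum; apply: eq_bigr => i _; rewrite raddf_sum /=.
by apply: eq_bigr => j _; rewrite mevalZ !mevalM !rmorphXn /= !mevalXU.
Qed.

Lemma corr_formK (C : comNzRingType) d e : cancel (@corr_form C d e) (@corr_coefs C d e).
Proof.
move=> a; apply/matrixP => i j; rewrite mxE corr_formE (raddf_sum (mcoeff _)).
rewrite (bigD1 i) //= (raddf_sum (mcoeff _)) (bigD1 j) //= mcoeffZ mcoeffX eqxx mulr1.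
rewrite !big1 ?addr0 // => [i' ne|j' ne].
  rewrite raddf_sum big1 // => j' _ /=; rewrite mcoeffZ mcoeffX.
  case: eqP => [/mnmP/(_ (inord 1))|_]; last by rewrite mulr0.
  rewrite !multinomE !(tnth_nth 0%N) /= inordK //= => /val_inj e1.
  by rewrite e1 eqxx in ne.
rewrite mcoeffZ mcoeffX.
case: eqP => [/mnmP/(_ (inord 3))|_]; last by rewrite mulr0.
rewrite !multinomE !(tnth_nth 0%N) /= inordK //= => /val_inj e1.
by rewrite e1 eqxx in ne.
Qed.

Lemma binary_form_lin (C : comNzRingType) (N m : nat) (c : nat -> C) (u v : C)
    (X Y : {mpoly C[N]}) :
  exists c' : nat -> C, (u *: X + v *: Y) * (\sum_(l < m.+1) c l *: (X ^+ (m - l) * Y ^+ l)) =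
     \sum_(l < m.+2) c' l *: (X ^+ (m.+1 - l) * Y ^+ l).
Proof.
exists (fun l => (if (l <= m)%N then u * c l else 0) + (if l is l'.+1 then v * c l' else 0)).
under [RHS]eq_bigr do rewrite scalerDl.
rewrite big_split /= mulrDl; congr (_ + _).
  rewrite [RHS]big_ord_recr /= ltnn scale0r addr0 mulr_sumr; apply: eq_bigr => l _.
  by rewrite -ltnS ltn_ord -scalerAl -scalerAr scalerA mulrA -exprS -subSn // -ltnS.
rewrite [RHS]big_ord_recl /= scale0r add0r mulr_sumr; apply: eq_bigr => l _.
by rewrite /bump /= add1n subSS -scalerAl -scalerAr scalerA mulrCA -exprS.
Qed.

Lemma binary_form_prod (C : comNzRingType) (N p q : nat) (u v u' v' : C)
    (X Y : {mpoly C[N]}) :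
  exists c : nat -> C, (u *: X + v *: Y) ^+ p * (u' *: X + v' *: Y) ^+ q =
     \sum_(l < (p + q).+1) c l *: (X ^+ (p + q - l) * Y ^+ l).
Proof.
elim: p => [|p [c IH]].
  elim: q => [|q [c IH]].
    by exists (fun _ => 1); rewrite big_ord1 !expr0 !mulr1 scale1r.
  have [c' E] := binary_form_lin q c u' v' X Y; exists c'.
  by rewrite add0n -E; rewrite expr0 mul1r add0n in IH; rewrite -IH expr0 mul1r exprS.
have [c' E] := binary_form_lin (p + q) c u v X Y; exists c'.
by rewrite addSn -E -IH exprS mulrA.
Qed.

(** The substitution preserves the bidegree, so reading off coefficients by [corr_coefs] in
    [corr_act] loses no monomial. *)
Lemma corr_form_subst (C : comNzRingType) d e (a : 'M[C]_(d.+1, e.+1)) (g : 'M[C]_2) :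
  let r0 := inord 0 : 'I_2 in let r1 := inord 1 : 'I_2 in
  let x0 : {mpoly C[4]} := 'X_(inord 0) in let x1 : {mpoly C[4]} := 'X_(inord 1) in
  let y0 : {mpoly C[4]} := 'X_(inord 2) in let y1 : {mpoly C[4]} := 'X_(inord 3) in
  exists b : 'M[C]_(d.+1, e.+1), corr_form a \mPo
    [tuple g r0 r0 *: x0 + g r0 r1 *: x1; g r1 r0 *: x0 + g r1 r1 *: x1;
           g r0 r0 *: y0 + g r0 r1 *: y1; g r1 r0 *: y0 + g r1 r1 *: y1] = corr_form b.
Proof.
move=> r0 r1 x0 x1 y0 y1.
pose P (p : {mpoly C[4]}) := exists b : 'M[C]_(d.+1, e.+1), p = corr_form b.
have P0 : P 0.
  exists 0; rewrite /corr_form big1 // => i _; rewrite big1 // => j _.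
  by rewrite mxE scale0r.
have PD p q : P p -> P q -> P (p + q).
  move=> [b ->] [b' ->]; exists (b + b'); rewrite /corr_form -big_split; apply: eq_bigr => i _.
  by rewrite -big_split; apply: eq_bigr => j _; rewrite mxE scalerDl.
have PZ c p : P p -> P (c *: p).
  move=> [b ->]; exists (c *: b); rewrite /corr_form scaler_sumr; apply: eq_bigr => i _.
  by rewrite scaler_sumr; apply: eq_bigr => j _; rewrite mxE scalerA.
suff : P (corr_form a \mPo [tuple g r0 r0 *: x0 + g r0 r1 *: x1; g r1 r0 *: x0 + g r1 r1 *: x1;
           g r0 r0 *: y0 + g r0 r1 *: y1; g r1 r0 *: y0 + g r1 r1 *: y1]) by [].
rewrite /corr_form (raddf_sum (comp_mpoly _)); apply: (big_ind P) => // i _.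
rewrite (raddf_sum (comp_mpoly _)); apply: (big_ind P) => // j _ /=.
rewrite comp_mpolyZ; apply: PZ; rewrite !rmorphM !rmorphXn /= !comp_mpolyXU !inordK //=.
have [c E] := binary_form_prod (d - i) i (g r0 r0) (g r0 r1) (g r1 r0) (g r1 r1) x0 x1.
have [c' E'] := binary_form_prod (e - j) j (g r0 r0) (g r0 r1) (g r1 r0) (g r1 r1) y0 y1.
rewrite -mulrA E E' !subnK -1?ltnS ?ltn_ord //.
exists (\matrix_(i, j) (c i * c' j)); rewrite mulr_suml; apply: eq_bigr => l _.
rewrite mulr_sumr; apply: eq_bigr => m _.
by rewrite mxE -scalerAl -scalerAr scalerA !mulrA.
Qed.

Lemma fev_act (C : comNzRingType) d e (a : 'M[C]_(d.+1, e.+1)) (g : 'M[C]_2) (x0 x1 y0 y1 : C) :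
  let r0 := inord 0 : 'I_2 in let r1 := inord 1 : 'I_2 in
  fev (corr_act g a) x0 x1 y0 y1 =
  fev a (g r0 r0 * x0 + g r0 r1 * x1) (g r1 r0 * x0 + g r1 r1 * x1)
        (g r0 r0 * y0 + g r0 r1 * y1) (g r1 r0 * y0 + g r1 r1 * y1).
Proof.
move=> r0 r1; have [b E] := corr_form_subst a g.
pose h (i : 'I_4) := nth 0 [:: x0; x1; y0; y1] i.
have hE m : (m < 4)%N -> h (inord m) = nth 0 [:: x0; x1; y0; y1] m.
  by move=> m4; rewrite /h inordK.
transitivity (corr_form b).@[h].
  by rewrite /corr_act E corr_formK meval_corr_form !hE.
rewrite -E comp_mpoly_meval meval_corr_form !(tnth_nth 0) !inordK //=.
by rewrite !mevalD !mevalZ !mevalXU !hE.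
Qed.

Lemma fev_map (C C' : comNzRingType) (f : {rmorphism C -> C'}) d e
    (a : 'M[C]_(d.+1, e.+1)) (x0 x1 y0 y1 : C) :
  f (fev a x0 x1 y0 y1) = fev (map_mx f a) (f x0) (f x1) (f y0) (f y1).
Proof.
rewrite /fev rmorph_sum; apply: eq_bigr => i _.
by rewrite rmorph_sum; apply: eq_bigr => j _; rewrite !rmorphM !rmorphXn mxE.
Qed.

Lemma sum_antidiag (C : comNzRingType) d e (w : 'I_d.+1 -> 'I_e.+1 -> C) (h : nat -> C) :
  \sum_(l < (d + e).+1) (\sum_i \sum_j (w i j *+ (i + j == l)%N)) * h l =
  \sum_i \sum_j w i j * h (i + j)%N.
Proof.
under eq_bigr do rewrite mulr_suml.
rewrite exchange_big; apply: eq_bigr => i _ /=; under eq_bigr do rewrite mulr_suml.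
rewrite exchange_big; apply: eq_bigr => j _ /=.
have lt : (i + j < (d + e).+1)%N by have := ltn_ord i; have := ltn_ord j; lia.
rewrite (bigD1 (Ordinal lt)) //= eqxx mulr1n big1 ?addr0 // => l.
by rewrite -val_eqE eq_sym /= => /negbTE->; rewrite mulr0n mul0r.
Qed.

Lemma hom_eval_Fcoef (C : comNzRingType) d e (a : 'M[C]_(d.+1, e.+1)) (z0 z1 : C) :
  hom_eval (d + e) (Fcoef a) z0 z1 = fev a z0 z1 z0 z1.
Proof.
rewrite /hom_eval (sum_antidiag a (fun l => z0 ^+ (d + e - l) * z1 ^+ l)).
apply: eq_bigr => i _; apply: eq_bigr => j _.
have -> : (d + e - (i + j) = (d - i) + (e - j))%N by have := ltn_ord i; have := ltn_ord j; lia.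
by rewrite !exprD; ring.
Qed.

Lemma hom_eval_Gcoef (C : comNzRingType) d e (a : 'M[C]_(d.+1, e.+1)) (z0 z1 : C) :
  hom_eval (d + e) (Gcoef a) z0 z1 = \sum_(i < d.+1) \sum_(j < e.+1)
    a i j * ((e * i)%:R - (d * j)%:R) *
      (z0 ^+ (d - i) * z1 ^+ i * z0 ^+ (e - j) * z1 ^+ j).
Proof.
rewrite /hom_eval.
transitivity (\sum_(l < (d + e).+1) (\sum_(i < d.+1) \sum_(j < e.+1)
    ((a i j * ((e * i)%:R - (d * j)%:R)) *+ (i + j == l)%N)) *
       (z0 ^+ (d + e - l) * z1 ^+ l)).
  apply: eq_bigr => l _; congr (_ * _); apply: eq_bigr => i _; apply: eq_bigr => j _.
  by rewrite mulrnAl.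
rewrite (sum_antidiag _ (fun l => z0 ^+ (d + e - l) * z1 ^+ l)).
apply: eq_bigr => i _; apply: eq_bigr => j _.
have -> : (d + e - (i + j) = (d - i) + (e - j))%N by have := ltn_ord i; have := ltn_ord j; lia.
by rewrite !exprD; ring.
Qed.

Lemma deriv_lin_exp (C : comNzRingType) (z u : C) m :
  ((z%:P + u%:P * 'X) ^+ m)^`().[0] = m%:R * z ^+ m.-1 * u.
Proof.
rewrite deriv_exp hornerMn hornerM horner_exp derivD derivC add0r mul_polyC derivZ derivX.
rewrite !hornerD !hornerZ !hornerC !hornerX mulr0 addr0 mulr1 -mulr_natl; ring.
Qed.

(** A logarithmic derivative at [X = 0]; the factor [z0 * z1] clears the denominators and keeps the
    identity valid over a ring. *)
Lemma monomial_deriv (C : comNzRingType) (z0 z1 u0 u1 v0 v1 : C) (p q r s : nat) :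
  z0 * z1 * ((z0%:P + u0%:P * 'X) ^+ p * (z1%:P + u1%:P * 'X) ^+ q *
     (z0%:P + v0%:P * 'X) ^+ r * (z1%:P + v1%:P * 'X) ^+ s)^`().[0] =
  (z1 * (p%:R * u0 + r%:R * v0) + z0 * (q%:R * u1 + s%:R * v1)) *
     (z0 ^+ p * z1 ^+ q * z0 ^+ r * z1 ^+ s).
Proof.
have lin0 (z u : C) : (z%:P + u%:P * 'X).[0] = z.
  by rewrite hornerD hornerM !hornerC hornerX mulr0 addr0.
have pw (z : C) m : z * (m%:R * z ^+ m.-1) = m%:R * z ^+ m.
  by case: m => [|m]; rewrite ?mul0r ?mulr0 // exprS; ring.
rewrite !derivM !(deriv_lin_exp, lin0, horner_exp, hornerM, hornerD).
have := (pw z0 p, pw z1 q, pw z0 r, pw z1 s).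
move: (p%:R * z0 ^+ p.-1) (q%:R * z1 ^+ q.-1) (r%:R * z0 ^+ r.-1) (s%:R * z1 ^+ s.-1).
move=> P Q R S [[[eP eQ] eR] eS].
transitivity (z1 * (z0 * P * u0 * z1 ^+ q * z0 ^+ r * z1 ^+ s +
    z0 * R * v0 * z0 ^+ p * z1 ^+ q * z1 ^+ s) + z0 *
    (z1 * Q * u1 * z0 ^+ p * z0 ^+ r * z1 ^+ s + z1 * S * v1 * z0 ^+ p * z1 ^+ q * z0 ^+ r)).
  by ring.
by rewrite eP eQ eR eS; ring.
Qed.

(* The derivative of f at (z, z) in the direction (e w, - d w) is
   H(z) (z0 w1 - z1 w0), which is how H inherits its equivariance from f. *)
Lemma fev_deriv (C : comNzRingType) d e (a : 'M[C]_(d.+1, e.+1)) (z0 z1 w0 w1 : C) :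
  z0 * z1 * (fev (map_mx polyC a)
     (z0%:P + (e%:R * w0)%:P * 'X) (z1%:P + (e%:R * w1)%:P * 'X)
     (z0%:P + (- (d%:R * w0))%:P * 'X) (z1%:P + (- (d%:R * w1))%:P * 'X))^`().[0] =
  (z0 * w1 - z1 * w0) * hom_eval (d + e) (Gcoef a) z0 z1.
Proof.
rewrite hom_eval_Gcoef /fev raddf_sum horner_sum !mulr_sumr; apply: eq_bigr => i _.
rewrite raddf_sum horner_sum !mulr_sumr; apply: eq_bigr => j _ /=.
rewrite mxE [X in X^`()]mul_polyC derivZ hornerZ mulrCA monomial_deriv.
rewrite !natrB -1?ltnS ?ltn_ord // !natrM; ring.
Qed.

Lemma hom_eval_prod (C : comNzRingType) (c : C) (n : nat) (al : 'I_n -> C) (z0 z1 : C) :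
  hom_eval n (fun l => (c *: \prod_i ('X - (al i)%:P))`_l) z0 z1 =
  c * \prod_i (z1 - al i * z0).
Proof.
elim: n al => [|n IH] al.
  by rewrite /hom_eval big_ord1 !big_ord0 coefZ coefC /= !mulr1.
rewrite [in RHS]big_ord_recl mulrCA -IH mulrBl /hom_eval.
have -> : c *: \prod_i ('X - (al i)%:P) =
    ('X - (al ord0)%:P) * (c *: \prod_i ('X - (al (lift ord0 i))%:P)).
  by rewrite big_ord_recl scalerAr.
have szq : (size (c *: \prod_i ('X - (al (lift ord0 i))%:P))%R <= n.+1)%N.
  by apply: leq_trans (size_scale_leq _ _) _; rewrite size_prod_ord.
move: (c *: _) szq => q szq.
under [LHS]eq_bigr do rewrite mulrBl coefB coefXM coefCM mulrBl.
rewrite sumrB; congr (_ - _).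
  rewrite big_ord_recl /= mul0r add0r mulr_sumr; apply: eq_bigr => l _.
  by rewrite /bump /= add1n subSS exprS; ring.
rewrite big_ord_recr /= [X in _ + X](_ : _ = 0) ?addr0; last first.
  by rewrite nth_default ?mulr0 ?mul0r.
rewrite mulr_sumr; apply: eq_bigr => l _.
by rewrite subSn -1?ltnS // exprS; ring.
Qed.

Lemma hom_eval1 (C : comNzRingType) n (p : nat -> C) (z : C) :
  hom_eval n p 1 z = \sum_(l < n.+1) p l * z ^+ l.
Proof. by apply: eq_bigr => l _; rewrite expr1n mul1r. Qed.

Lemma Fcoef0_fev (C : comNzRingType) d e (a : 'M[C]_(d.+1, e.+1)) :
  Fcoef a 0 = fev a 1 0 1 0.
Proof.
rewrite -hom_eval_Fcoef hom_eval1 big_ord_recl expr0 mulr1 big1 ?addr0 // => l _.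
by rewrite lift0 exprS mul0r mulr0.
Qed.

Lemma Fcoef_max_fev (C : comNzRingType) d e (a : 'M[C]_(d.+1, e.+1)) :
  Fcoef a (d + e) = fev a 0 1 0 1.
Proof.
rewrite -hom_eval_Fcoef /hom_eval big_ord_recr /= subnn expr0 expr1n !mulr1.
rewrite big1 ?add0r // => l _.
by rewrite expr0n subn_eq0 leqNgt ltn_ord mul0r mulr0.
Qed.

Lemma coef_sum_rev (C : comNzRingType) (n : nat) (t : nat -> C) (j : nat) : (j <= n)%N ->
  (\sum_(i < n.+1) (t i)%:P * 'X^(n - i))`_(n - j) = t j.
Proof.
move=> jn; have jn1 : (j < n.+1)%N by [].
rewrite coef_sum (bigD1 (Ordinal jn1)) //= coefCM coefXn eqxx mulr1 big1 ?addr0 // => i.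
rewrite -val_eqE /= => ij; rewrite coefCM coefXn.
have -> : (n - j == n - i)%N = false by have := ltn_ord i; lia.
by rewrite mulr0.
Qed.

Lemma hom_evalZ (C : comNzRingType) n (p : nat -> C) (u z0 z1 : C) :
  hom_eval n p (u * z0) (u * z1) = u ^+ n * hom_eval n p z0 z1.
Proof.
rewrite /hom_eval mulr_sumr; apply: eq_bigr => l _.
have -> : u ^+ n = u ^+ (n - l) * u ^+ l by rewrite -exprD subnK // -ltnS.
by rewrite !exprMn; ring.
Qed.

Lemma corr_act_map (C C' : comNzRingType) (f : {rmorphism C -> C'}) d e
    (g : 'M[C]_2) (a : 'M[C]_(d.+1, e.+1)) :
  map_mx f (corr_act g a) = corr_act (map_mx f g) (map_mx f a).
Proof.
apply/matrixP => i j; rewrite /corr_act !mxE -(mcoeff_map_mpoly f); congr (mcoeff _ _).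
rewrite /corr_form !(raddf_sum (comp_mpoly _)) raddf_sum; apply: eq_bigr => i' _ /=.
rewrite !(raddf_sum (comp_mpoly _)) raddf_sum; apply: eq_bigr => j' _ /=.
rewrite !comp_mpolyZ map_mpolyZ mxE; congr (_ *: _).
rewrite !rmorphM !rmorphXn /= !comp_mpolyXU !inordK //=.
by rewrite !rmorphD /= !map_mpolyZ !map_mpolyX.
Qed.

Section Invariance.
Variables (L : fieldType) (d e : nat) (g : 'M[L]_2) (a : 'M[L]_(d.+1, e.+1)).
Variables (c : L) (al : 'I_(d + e) -> L).
Hypotheses (L0 : [pchar L] =i pred0) (n_gt1 : (1 < d + e)%N).

Local Notation g00 := (g (inord 0) (inord 0)).
Local Notation g01 := (g (inord 0) (inord 1)).
Local Notation g10 := (g (inord 1) (inord 0)).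
Local Notation g11 := (g (inord 1) (inord 1)).
Local Notation ga := (corr_act g a).
(** The root [al i] is the point [[1 : al i]] of the projective line; its image under the inverse of
    [g] is [[de i : be i]], so the transformed form has the root [al' i]. *)
Let de i := g11 - al i * g01.
Let be i := al i * g00 - g10.
Let al' i := be i / de i.

Hypothesis detg : g00 * g11 - g01 * g10 = 1.
Hypothesis FE : Fpoly a = c *: \prod_i ('X - (al i)%:P).
Hypothesis c0 : c != 0.
Hypothesis F0 : Fcoef a 0 != 0.
Hypothesis Fn' : Fcoef ga (d + e) != 0.
Hypothesis F0' : Fcoef ga 0 != 0.

Lemma Fpoly_act : Fpoly ga = c *: \prod_i ((de i)%:P * 'X - (be i)%:P).
Proof.
have -> : Fpoly ga = hom_eval (d + e) (Fcoef (map_mx polyC ga)) 1 'X.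
  rewrite hom_eval1 /Fpoly poly_def; apply: eq_bigr => l _.
  by rewrite -Fcoef_map mul_polyC.
have -> : hom_eval (d + e) (Fcoef (map_mx polyC ga)) 1 'X =
    hom_eval (d + e) (Fcoef (map_mx polyC a)) (g00%:P + g01%:P * 'X) (g10%:P + g11%:P * 'X).
  by rewrite !hom_eval_Fcoef corr_act_map fev_act !mxE !mulr1.
transitivity (hom_eval (d + e) (fun l => (c%:P *: \prod_i ('X - ((al i)%:P)%:P))`_l)
   (g00%:P + g01%:P * 'X) (g10%:P + g11%:P * 'X)).
  apply: eq_bigr => l _; congr (_ * _).
  rewrite -Fcoef_map -Fpoly_coef -1?ltnS // FE -(coef_map (@polyC L)) map_polyZ rmorph_prod /=.
  rewrite [in LHS](eq_bigr (fun i => 'X - ((al i)%:P)%:P)) // => i _.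
  by rewrite rmorphB /= map_polyX map_polyC.
rewrite hom_eval_prod -[RHS]mul_polyC.
rewrite [in LHS](eq_bigr (fun i => (de i)%:P * 'X - (be i)%:P)) // => i _.
by rewrite /de /be !rmorphB !rmorphM /=; ring.
Qed.

Lemma prod_de : Fcoef ga (d + e) = c * \prod_i de i.
Proof.
rewrite Fcoef_max_fev fev_act !mulr0 !add0r !mulr1 -hom_eval_Fcoef.
transitivity (hom_eval (d + e) (fun l => (c *: \prod_i ('X - (al i)%:P))`_l) g01 g11).
  by apply: eq_bigr => l _; rewrite -FE Fpoly_coef // -ltnS.
by rewrite hom_eval_prod.
Qed.

Lemma de_neq0 i : de i != 0.
Proof.
apply: contraNneq Fn' => de0.
by rewrite prod_de (bigD1 i) //= de0 mul0r mulr0.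
Qed.

Lemma Fpoly_act_roots : Fpoly ga = Fcoef ga (d + e) *: \prod_i ('X - (al' i)%:P).
Proof.
rewrite Fpoly_act prod_de -scalerA; congr (_ *: _).
rewrite -mul_polyC rmorph_prod -big_split; apply: eq_bigr => i _ /=.
by rewrite mulrBr -rmorphM /al' mulrCA divff ?de_neq0 // mulr1.
Qed.

Lemma root_neq0 (b : 'M[L]_(d.+1, e.+1)) (u : L) (r : 'I_(d + e) -> L) i :
  Fpoly b = u *: \prod_i ('X - (r i)%:P) -> Fcoef b 0 != 0 -> r i != 0.
Proof.
move=> bE; apply: contraNneq => r0.
rewrite -Fpoly_coef // bE coefZ -horner_coef0 horner_prod (bigD1 i) //=.
by rewrite hornerXsubC r0 subr0 mul0r mulr0.
Qed.

(** The derivative of [fev_deriv] is computed twice: for [ga] at [(de i, be i)] with [w = (0, 1)],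
    and for [a] at their images under [g], which are [(1, al i)] and [(g01, g11)]. *)
Lemma Hpoly_act i : de i ^+ (d + e - 2) * (Hpoly ga).[al' i] = (Hpoly a).[al i].
Proof.
have al0 : al i != 0 by exact: root_neq0 FE F0.
have al'0 : al' i != 0 by exact: root_neq0 Fpoly_act_roots F0'.
have be0 : be i != 0 by apply: contraNneq al'0 => h; rewrite /al' h mul0r.
have d0 := de_neq0 i.
have E1 := fev_deriv ga (de i) (be i) 0 1.
have E2 := fev_deriv a 1 (al i) g01 g11.
have gz0 : g00 * de i + g01 * be i = 1 by rewrite -detg /de /be; ring.
have gz1 : g10 * de i + g11 * be i = al i.
  by rewrite -[RHS]mulr1 -detg /de /be; ring.
have D12 : fev (map_mx polyC ga)
     ((de i)%:P + (e%:R * 0)%:P * 'X) ((be i)%:P + (e%:R * 1)%:P * 'X)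
     ((de i)%:P + (- (d%:R * 0))%:P * 'X) ((be i)%:P + (- (d%:R * 1))%:P * 'X) =
  fev (map_mx polyC a)
     (1%:P + (e%:R * g01)%:P * 'X) ((al i)%:P + (e%:R * g11)%:P * 'X)
     (1%:P + (- (d%:R * g01))%:P * 'X) ((al i)%:P + (- (d%:R * g11))%:P * 'X).
  rewrite corr_act_map fev_act !mxE !mulr0 !mulr1 oppr0 polyC0.
  have e1P : 1%:P = g00%:P * (de i)%:P + g01%:P * (be i)%:P.
    by rewrite -!rmorphM -rmorphD gz0.
  have eaP : (al i)%:P = g10%:P * (de i)%:P + g11%:P * (be i)%:P.
    by rewrite -!rmorphM -rmorphD gz1.
  by congr (fev _ _ _ _ _); rewrite ?e1P ?eaP !(rmorphN, rmorphM) /=; ring.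
rewrite D12 in E1; move: E1 E2; move: (_^`().[0]) => D E1 E2.
rewrite mulr1 mulr0 subr0 -[X in hom_eval _ _ X _]mulr1 in E1.
have beE : be i = de i * al' i by rewrite /al' mulrCA divff ?mulr1.
rewrite beE hom_evalZ hom_eval1 Gcoef_Hpoly // in E1.
rewrite hom_eval1 Gcoef_Hpoly // mul1r mul1r in E2.
have gd : g11 - al i * g01 = de i by [].
rewrite gd in E2.
have {}E2 : D = de i * (Hpoly a).[al i] by apply: (mulfI al0); rewrite E2; ring.
have dn : de i ^+ (d + e) = de i * (de i * de i ^+ (d + e - 2)).
  by rewrite -!exprS; congr (_ ^+ _); lia.
rewrite dn E2 in E1.
have nz : de i * de i * de i * al' i != 0.
  exact: mulf_neq0 (mulf_neq0 (mulf_neq0 d0 d0) d0) al'0.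
by apply: (mulfI nz); apply: etrans (esym _); first (apply: etrans (esym E1)); ring.
Qed.

(** As [\det g = 1], a difference of new roots is [(al i - al j) / (de i * de j)]. In [F'], a
    product of [d + e - 1] such differences, the [de j] with [j != i] cancel against the new leading
    coefficient [c * \prod_i de i]. *)
Lemma Fderiv_act i : de i ^+ (d + e - 2) * (Fpoly ga)^`().[al' i] = (Fpoly a)^`().[al i].
Proof.
have d0 := de_neq0.
rewrite Fpoly_act_roots FE !deriv_prod_root prod_de (bigD1 i) //=.
have sub j : al' i - al' j = (al i - al j) / (de i * de j).
  rewrite -[al i - al j]mulr1 -detg.
  have -> : (al i - al j) * (g00 * g11 - g01 * g10) = be i * de j - be j * de i.
    by rewrite /be /de; ring.
  by rewrite /al'; field; rewrite !d0.
have -> : \prod_(j | j != i) (al' i - al' j) =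
    \prod_(j | j != i) ((al i - al j) * ((de i)^-1 * (de j)^-1)).
  by apply: eq_bigr => j _; rewrite sub invfM.
rewrite big_split /= big_split /= !prodfV prodr_const.
have -> : #|[pred j | j != i]| = (d + e - 2).+1.
  by rewrite cardC1 card_ord; lia.
have nz : \prod_(j | j != i) de j != 0 by apply/prodf_neq0 => j _; apply: d0.
rewrite exprS.
have nzi : de i ^+ (d + e - 2) != 0 by rewrite expf_neq0.
have ar (x y z u w : L) : x != 0 -> y != 0 -> z != 0 ->
    y * (u * (z * x) * (w * ((z * y)^-1 / x))) = u * w.
  by move=> x0 y0 z0; field; rewrite x0 y0 z0.
exact: ar.
Qed.

(** Each linear factor for [a] is [de i ^+ (d + e - 2)] times the one for [ga], and these powers
    make up for the change of leading coefficient. *)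
Lemma tcoef_act j : (j <= d + e)%N -> tcoef ga j = tcoef a j.
Proof.
move=> jn.
suff E : \sum_(i < (d + e).+1) (tcoef ga i)%:P * 'X^(d + e - i) =
    \sum_(i < (d + e).+1) (tcoef a i)%:P * 'X^(d + e - i).
  by rewrite -(coef_sum_rev (tcoef ga) jn) E coef_sum_rev.
rewrite (tcoef_roots L0 n_gt1 c0 (fun i => root_neq0 i FE F0) FE).
rewrite (tcoef_roots L0 n_gt1 Fn' (fun i => root_neq0 i Fpoly_act_roots F0') Fpoly_act_roots).
rewrite prod_de exprMn -prodrXl rmorphM rmorph_prod -mulrA -big_split; congr (_ * _).
apply: eq_bigr => i _ /=.
by rewrite -Fderiv_act -Hpoly_act !rmorphM /=; ring.
Qed.

End Invariance.

(** * Splitting fields *)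

Lemma irreducible_or_factor (F : fieldType) (p : {poly F}) : (1 < size p)%N ->
  irreducible_poly p \/ exists q : {poly F}, [/\ (1 < size q)%N, (size q < size p)%N & q %| p].
Proof.
move=> p1; have [|/not_and_or[//|/not_all_ex_not[q h]]] := classic (irreducible_poly p); first by left.
have [q1 {}h] := imply_to_and _ _ h; have [qp /negP nqp] := imply_to_and _ _ h.
right; exists q.
have p0 : p != 0 by rewrite -size_poly_gt0; apply: ltnW.
have q0 : q != 0 by apply: contraNneq p0 => q0; rewrite -dvd0p -q0.
split=> //; first by rewrite ltn_neqAle eq_sym q1 size_poly_gt0.
by rewrite ltn_neqAle dvdp_leq // andbT dvdp_size_eqp.
Qed.

(** Induction on the degree: an irreducible polynomial acquires a root in the field it defines, and
    otherwise a root of a proper factor serves. *)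
Lemma exists_root_ext (F : fieldType) (p : {poly F}) : (1 < size p)%N ->
  exists (L : fieldType) (f : {rmorphism F -> L}) (z : L), root (map_poly f p) z.
Proof.
have [n] := ubnP (size p); elim: n p => // n IH p; rewrite ltnS => pn p1.
have [/irredp_FAdjoin[L _ [z pz _]]|[q [q1 qp q_p]]] := irreducible_or_factor p1.
  by exists L, (in_alg L), z.
have [L [f [z qz]]] := IH q (leq_trans qp pn) q1.
exists L, f, z; rewrite -dvdp_XsubCl in qz; rewrite -dvdp_XsubCl.
by apply: dvdp_trans qz _; rewrite dvdp_map.
Qed.

Lemma exists_splitting (F : fieldType) (p : {poly F}) : p != 0 ->
  exists (L : fieldType) (f : {rmorphism F -> L}) (rs : seq L),
    map_poly f p = f (lead_coef p) *: \prod_(r <- rs) ('X - r%:P).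
Proof.
have [n] := ubnP (size p); elim: n F p => // n IH F p; rewrite ltnS => pn p0.
have [p1|p1] := leqP (size p) 1.
  exists F, idfun, [::]; rewrite big_nil map_poly_id // alg_polyC.
  by rewrite [p in LHS]size1_polyC // lead_coefE; case: (size p) p1 => [|[|]].
have [L1 [f1 [z /factor_theorem[q qE]]]] := exists_root_ext p1.
have p10 : map_poly f1 p != 0 by rewrite map_poly_eq0.
have q0 : q != 0 by apply: contraNneq p10 => q0; rewrite qE q0 mul0r.
have sq : (size q < n)%N.
  apply: leq_trans pn; rewrite -(size_map_poly f1) qE size_Mmonic ?monicXsubC //.
  by rewrite size_XsubC addn2.
have [L [f [rs E]]] := IH L1 q sq q0.
exists L, (f \o f1), (f z :: rs).
rewrite map_poly_comp qE rmorphM /= E big_cons rmorphB /= map_polyX map_polyC /=.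
rewrite -scalerAl mulrC; congr (_ *: _); congr (f _).
by rewrite -lead_coef_map qE lead_coef_Mmonic ?monicXsubC.
Qed.

Lemma pchar_rmorph (F : fieldType) (L : fieldType) (f : {rmorphism F -> L}) :
  [pchar F] =i pred0 -> [pchar L] =i pred0.
Proof. by move=> h p; rewrite -(h p) (fmorph_pchar f). Qed.

Lemma prod_seq_ord (L : comNzRingType) (rs : seq L) (n : nat) : size rs = n ->
  exists al : 'I_n -> L, \prod_(r <- rs) ('X - r%:P) = \prod_i ('X - (al i)%:P).
Proof.
by move=> <-; exists (fun i => rs`_i); rewrite (big_nth 0) big_mkord.
Qed.

Lemma Fpoly_map (C C' : comNzRingType) (f : {rmorphism C -> C'}) d e
    (a : 'M[C]_(d.+1, e.+1)) : Fpoly (map_mx f a) = map_poly f (Fpoly a).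
Proof.
apply/polyP => l; rewrite coef_map !coef_poly.
case: ifP => _; first exact: esym (Fcoef_map f a l).
exact: esym (rmorph0 f).
Qed.

Lemma fev_delta (C : comNzRingType) d e i0 j0 (x0 x1 y0 y1 : C) :
  fev (delta_mx i0 j0 : 'M[C]_(d.+1, e.+1)) x0 x1 y0 y1 =
  x0 ^+ (d - i0) * x1 ^+ i0 * y0 ^+ (e - j0) * y1 ^+ j0.
Proof.
rewrite /fev (bigD1 i0) //= (bigD1 j0) //= mxE !eqxx mul1r !big1 ?addr0 // => [i|j] ne.
  by rewrite big1 // => j _; rewrite mxE (negbTE ne) mul0r.
by rewrite mxE (negbTE ne) andbF mul0r.
Qed.

(** * The generic form over a splitting field *)

Section GenericPoint.
Variables (k : fieldType) (d e : nat).
Hypothesis k0 : [pchar k] =i pred0.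

Local Notation A := (corr_ring k d e).
Local Notation gen := (generic_corr k d e).

Lemma mmap_gen (C : comNzRingType) (f : {rmorphism k -> C}) (b : 'M[C]_(d.+1, e.+1)) :
  map_mx (mmap f (fun l => mxvec b 0 l)) gen = b.
Proof. by apply/matrixP => i j; rewrite !mxE mmapX mmap1U mxvecE. Qed.

(** Otherwise the specialisations to [x0^d y0^e] and [x1^d y1^e] would force [u = v = 0]. *)
Lemma fev_gen_neq0 (u v : k) : (u != 0) || (v != 0) ->
  fev gen u%:MP v%:MP u%:MP v%:MP != 0.
Proof.
move=> uv; apply/eqP => f0.
have spec (b : 'M[k]_(d.+1, e.+1)) : fev b u v u v = 0.
  pose f : {rmorphism A -> k} := mmap idfun (fun l => mxvec b 0 l).
  by have := fev_map f gen u%:MP v%:MP u%:MP v%:MP; rewrite f0 rmorph0 mmap_gen /= !mmapC.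
have := spec (delta_mx ord0 ord0); have := spec (delta_mx ord_max ord_max).
rewrite !fev_delta /= !subnn !subn0 !expr0 !mulr1 !mul1r -!exprD.
move=> /eqP; rewrite expf_eq0 => /andP[_ /eqP v0] /eqP; rewrite expf_eq0 => /andP[_ /eqP u0].
by rewrite u0 v0 eqxx in uv.
Qed.

(** The roots live in an extension of the fraction field of the polynomial ring. As [f] is
    injective, identities proved for them descend to the ring. *)
Lemma generic_splitting : exists (L : fieldType) (f : {rmorphism A -> L}) (al : 'I_(d + e) -> L),
  [/\ injective f, [pchar L] =i pred0 &
      Fpoly (map_mx f gen) = f (Fcoef gen (d + e)) *: \prod_i ('X - (al i)%:P)].
Proof.
pose K := {fraction A}.
have lead0 : Fcoef gen (d + e) != 0.
  by rewrite Fcoef_max_fev -[0](rmorph0 (@mpolyC _ k)) -[1](rmorph1 (@mpolyC _ k)) fev_gen_neq0 ?oner_eq0 ?orbT.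
pose p : {poly K} := map_poly (@tofrac A) (Fpoly gen).
have sF : size (Fpoly gen) = (d + e).+1 by rewrite size_poly_eq.
have inj0 : injective (@tofrac A) by move=> x y /eqP; rewrite tofrac_eq => /eqP.
have sp : size p = (d + e).+1 by rewrite size_map_inj_poly ?rmorph0.
have p0 : p != 0 by rewrite -size_poly_gt0 sp.
have [L [f [rs E]]] := exists_splitting p0.
have srs : size rs = (d + e)%N.
  apply: succn_inj; rewrite -(size_prod_XsubC rs id) -sp -(size_map_poly f p) E size_scale //.
  by rewrite fmorph_eq0 lead_coef_eq0.
have [al Eal] := prod_seq_ord srs.
exists L, (f \o @tofrac A), al; split.
- by move=> x y /= /fmorph_inj /inj0.
- apply: (@pchar_rmorph k L (f \o @tofrac A \o @mpolyC _ k)) => //.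
- rewrite -Eal; transitivity (map_poly f p).
    by rewrite /p -map_poly_comp (Fpoly_map (f \o @tofrac A)).
  rewrite E; congr (_ *: _); rewrite /= lead_coef_map_inj ?rmorph0 //.
  by rewrite lead_coefE sF /= Fpoly_coef.
Qed.

Lemma det_mx2 (C : comNzRingType) (g : 'M[C]_2) : \det g =
  g (inord 0) (inord 0) * g (inord 1) (inord 1) - g (inord 0) (inord 1) * g (inord 1) (inord 0).
Proof.
have -> : inord 0 = ord0 :> 'I_2 by apply: val_inj; rewrite /= inordK.
have -> : inord 1 = lift ord0 ord0 :> 'I_2 by apply: val_inj; rewrite /= inordK.
rewrite (expand_det_row _ ord0) !big_ord_recl big_ord0 addr0 /cofactor !det_mx11 !mxE /=.
rewrite expr0 mul1r expr1 mulN1r mulrN.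
by congr (_ * g _ _ - _ * g _ _); apply: val_inj.
Qed.

Lemma SL2_invariant_tcoef j : (1 < d + e)%N -> (j <= d + e)%N ->
  SL2_invariant (tcoef gen j : A).
Proof.
move=> n1 jn g; rewrite det_mx2 => detg.
set lq := [tuple _ | l < _]; rewrite (tcoef_map (comp_mpoly lq)).
set gA := map_mx (@mpolyC (d.+1 * e.+1) k) g.
have -> : map_mx (comp_mpoly lq) gen = corr_act gA gen.
  by apply/matrixP => i j'; rewrite 2!mxE comp_mpolyXU -tnth_nth tnth_mktuple mxvecE.
have [L [f [al [f_inj L0 FE]]]] := generic_splitting.
apply: (f_inj); transitivity (tcoef (corr_act (map_mx f gA) (map_mx f gen)) j).
  by rewrite -corr_act_map; apply: tcoef_map.
transitivity (tcoef (map_mx f gen) j); last exact: esym (tcoef_map _ _ _).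
have f0 x : x != 0 -> f x != 0 by move=> x0; rewrite -(rmorph0 f) (inj_eq f_inj).
have g_row (u v : k) : u%:MP * 1 + v%:MP * 0 = u%:MP :> A by rewrite mulr1 mulr0 addr0.
have g_row' (u v : k) : u%:MP * 0 + v%:MP * 1 = v%:MP :> A by rewrite mulr1 mulr0 add0r.
apply: (tcoef_act L0 n1 _ FE) => //.
- by rewrite -det_mx2 !det_map_mx det_mx2 detg !rmorph1.
- by rewrite f0 // Fcoef_max_fev -[0](rmorph0 (@mpolyC _ k)) -[1](rmorph1 (@mpolyC _ k))
    fev_gen_neq0 ?oner_eq0 ?orbT.
- by rewrite -Fcoef_map f0 // Fcoef0_fev -[0](rmorph0 (@mpolyC _ k)) -[1](rmorph1 (@mpolyC _ k))
    fev_gen_neq0 ?oner_eq0.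
(* The extreme coefficients of the transformed form are the values of F at the columns of [g], which
   are nonzero because [\det g = 1]. *)
- rewrite -corr_act_map -Fcoef_map f0 // Fcoef_max_fev fev_act !mxE !g_row'.
  apply: fev_gen_neq0; rewrite -negb_and; apply/negP => /andP[/eqP h1 /eqP h2].
  by move/eqP: detg; rewrite h1 h2 mulr0 mul0r subrr eq_sym oner_eq0.
- rewrite -corr_act_map -Fcoef_map f0 // Fcoef0_fev fev_act !mxE !g_row.
  apply: fev_gen_neq0; rewrite -negb_and; apply/negP => /andP[/eqP h1 /eqP h2].
  by move/eqP: detg; rewrite h1 h2 mulr0 mul0r subrr eq_sym oner_eq0.
Qed.

End GenericPoint.

(** * The vanishing coefficient *)

Section Lagrange.
Variables (L : fieldType) (n : nat) (al : 'I_n -> L).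

(** Lagrange interpolation. The formula for the top coefficient is what later lowers the degree
    bound by one. *)
Lemma interpolation (v : 'I_n -> L) : injective al ->
  exists H : {poly L}, [/\ (size H <= n)%N, forall i, H.[al i] = v i &
    H`_n.-1 = \sum_i v i / \prod_(j | j != i) (al i - al j)].
Proof.
move=> al_inj.
have den0 i : \prod_(j | j != i) (al i - al j) != 0.
  by apply/prodf_neq0 => j ji; rewrite subr_eq0 (inj_eq al_inj) eq_sym.
have szp i : size (\prod_(j | j != i) ('X - (al j)%:P)) = n.
  rewrite -big_filter size_prod_XsubC -[RHS](card_ord n) (cardD1 i) inE add1n; congr _.+1.
  rewrite -sum1_size big_filter sum1_card.
  by apply: eq_card => j; rewrite !inE andbT.
exists (\sum_i (v i / \prod_(j | j != i) (al i - al j)) *: \prod_(j | j != i) ('X - (al j)%:P)).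
split=> [|i|].
- apply: leq_trans (size_sum _ _ _) _; apply/bigmax_leqP => i _.
  by apply: leq_trans (size_scale_leq _ _) _; rewrite szp.
- rewrite horner_sum (bigD1 i) //= [X in _ + X]big1 ?addr0 => [|j ji].
    rewrite hornerZ horner_prod; under [X in _ * X]eq_bigr do rewrite hornerXsubC.
    by rewrite mulfVK.
  move: (v j / _) => q.
  by rewrite hornerZ horner_prod (bigD1 i) 1?eq_sym //= hornerXsubC subrr mul0r mulr0.
rewrite coef_sum; apply: eq_bigr => i _; rewrite coefZ.
have /monicP := monic_prod_XsubC (index_enum 'I_n) (fun j => j != i) al.
by rewrite lead_coefE szp => ->; rewrite mulr1.
Qed.

Lemma lagrange_coef (H : {poly L}) : injective al -> (size H <= n)%N ->
  H`_n.-1 = \sum_i H.[al i] / \prod_(j | j != i) (al i - al j).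
Proof.
move=> al_inj sH; have [Q [sQ QE <-]] := interpolation (fun i => H.[al i]) al_inj.
suff -> : H = Q by [].
apply/eqP; rewrite -subr_eq0; apply/eqP.
apply: (@roots_geq_poly_eq0 _ _ (map al (enum 'I_n))).
- by apply/allP => x /mapP[i _ ->]; rewrite rootE hornerD hornerN QE subrr.
- by rewrite map_inj_uniq ?enum_uniq.
- rewrite size_map size_enum_ord; apply: leq_trans (size_polyD _ _) _.
  by rewrite geq_max sH size_polyN sQ.
Qed.

(** Vieta, once the leading coefficients [u i] are taken out of the factors. *)
Lemma coef_prod_affine (u v : 'I_n -> L) : (forall i, u i != 0) -> (0 < n)%N ->
  (\prod_i ((u i)%:P * 'X + (v i)%:P))`_n.-1 = (\prod_i u i) * \sum_i v i / u i.
Proof.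
move=> u0 n0.
have -> : \prod_i ((u i)%:P * 'X + (v i)%:P) =
    (\prod_i u i) *: \prod_i ('X - (- (v i / u i))%:P).
  rewrite -mul_polyC rmorph_prod -big_split; apply: eq_bigr => i _ /=.
  by rewrite rmorphN opprK mulrDr -rmorphM mulrCA divff ?mulr1.
rewrite coefZ; congr (_ * _).
have := @coefPn_prod_XsubC L (map (fun i => - (v i / u i)) (index_enum 'I_n)).
have -> : size (map (fun i => - (v i / u i)) (index_enum 'I_n)) = n.
  by rewrite size_map /index_enum; unlock; rewrite -enumT size_enum_ord.
by rewrite -lt0n => /(_ n0); rewrite !big_map sumrN opprK.
Qed.

End Lagrange.

Lemma tcoef1_eq0 (L : fieldType) d e (a : 'M[L]_(d.+1, e.+1)) (c : L)
    (al : 'I_(d + e) -> L) :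
  [pchar L] =i pred0 -> (1 < d + e)%N -> c != 0 -> (forall i, al i != 0) ->
  Fpoly a = c *: \prod_i ('X - (al i)%:P) -> tcoef a 1 = 0.
Proof.
move=> L0 n1 c0 al0 FE.
have n0 : (0 < d + e)%N by apply: ltnW.
rewrite -(coef_sum_rev (tcoef a) n0) subn1 (tcoef_roots L0 n1 c0 al0 FE) coefCM.
suff -> : (\prod_i ((2%:R * (Fpoly a)^`().[al i])%:P * 'X + ((Hpoly a).[al i])%:P))`_(d + e).-1 = 0.
  by rewrite mulr0.
have two0 : 2%:R != 0 :> L by move/pcharf0P: L0 => ->.
have [al_inj|] := classic (injective al).
  have den0 i : \prod_(j | j != i) (al i - al j) != 0.
    by apply/prodf_neq0 => j ji; rewrite subr_eq0 (inj_eq al_inj) eq_sym.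
  have F'E i : 2%:R * (Fpoly a)^`().[al i] = 2%:R * c * \prod_(j | j != i) (al i - al j).
    by rewrite FE deriv_prod_root mulrA.
  rewrite coef_prod_affine // => [|i]; last by rewrite F'E !mulf_neq0.
  (* By Lagrange the sum is a multiple of the coefficient of index [(d + e).-1] of [Hpoly a], which
     lies just beyond its degree bound. *)
  have -> : \sum_i (Hpoly a).[al i] / (2%:R * (Fpoly a)^`().[al i]) =
      (2%:R * c)^-1 * (Hpoly a)`_(d + e).-1.
    rewrite (lagrange_coef al_inj); last by apply: leq_trans (size_poly _ _) (leq_pred _).
    by rewrite mulr_sumr; apply: eq_bigr => i _; rewrite F'E invfM mulrCA.
  by rewrite nth_default ?mulr0 // size_poly.
(* If [al i = al j] is a repeated root, then [F'] vanishes there and two of the factors are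
   constants, so the product has degree at most [d + e - 2]. *)
move=> /not_all_ex_not[i /not_all_ex_not[j h]]; have [alij /eqP ij] := imply_to_and _ _ h.
have root_double i' j' : al i' = al j' -> i' != j' -> (Fpoly a)^`().[al i'] = 0.
  move=> e1 e2; rewrite FE deriv_prod_root (bigD1 j') 1?eq_sym //= e1 subrr mul0r mulr0 //.
rewrite (bigD1 i) //= (bigD1 j) 1?eq_sym //=.
rewrite (root_double i j) // (root_double j i) 1?eq_sym // mulr0 mul0r !add0r.
rewrite !coefCM nth_default ?mulr0 //.
apply: leq_trans (size_poly_prod_leq _ _) _.
have card2 : #|[pred m | (m != i) && (m != j)]| = (d + e - 2)%N.
  have := cardD1 i 'I_(d + e); have := cardD1 j [predD1 'I_(d + e) & i].
  rewrite !inE card_ord eq_sym ij /= => -> e2.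
  have -> : #|[pred m | (m != i) && (m != j)]| = #|[predD1 [predD1 'I_(d + e) & i] & j]|.
    by apply: eq_card => m; rewrite !inE andbT andbC.
  by move: e2; move: #|_| => m e2; lia.
rewrite leq_subLR; apply: (@leq_ltn_trans (\sum_(m | (m != i) && (m != j)) 2)%N).
  apply: leq_sum => m _; apply: leq_trans (size_polyD _ _) _.
  rewrite geq_max; apply/andP; split; last by apply: leq_trans (size_polyC_leq1 _) _.
  by apply: leq_trans (size_mul_leq _ _) _; rewrite size_polyX addn2 /= ltnS size_polyC_leq1.
by rewrite sum_nat_const card2; lia.
Qed.

Lemma tcoef1_generic (k : fieldType) d e : [pchar k] =i pred0 -> (1 < d + e)%N ->
  tcoef (generic_corr k d e) 1 = 0.
Proof.
move=> k0 n1; have [L [f [al [f_inj L0 FE]]]] := generic_splitting d e k0.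
have f0 x : x != 0 -> f x != 0 by move=> x0; rewrite -(rmorph0 f) (inj_eq f_inj).
have F00 : Fcoef (map_mx f (generic_corr k d e)) 0 != 0.
  rewrite -Fcoef_map f0 // Fcoef0_fev -[0](rmorph0 (@mpolyC _ k)) -[1](rmorph1 (@mpolyC _ k)).
  by rewrite fev_gen_neq0 ?oner_eq0.
apply: (f_inj); rewrite rmorph0; apply: etrans (tcoef_map _ _ _) _.
apply: (tcoef1_eq0 L0 n1 _ _ FE) => [|i]; last exact: root_neq0 FE F00.
rewrite f0 // Fcoef_max_fev -[0](rmorph0 (@mpolyC _ k)) -[1](rmorph1 (@mpolyC _ k)).
by rewrite fev_gen_neq0 ?oner_eq0 ?orbT.
Qed.

(** * Surjectivity onto the hyperplane *)

Section Antidiagonal.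
Variables (L : fieldType) (d e : nat).
Hypotheses (L0 : [pchar L] =i pred0) (d_gt0 : (0 < d)%N) (e_gt0 : (0 < e)%N).

Let nL : L := (d + e)%:R.
(** The weight [e i - d j] at the entry with the largest row index, [i = minn d l], on the
    antidiagonal [i + j = l]. At the entry [(i - 1, j + 1)] the weight is [W l - nL]. *)
Let W (l : nat) : L := (e * minn d l)%:R - (d * (l - minn d l))%:R.

Lemma antidiag_two (y : 'I_d.+1 -> 'I_e.+1 -> L) (l : nat) : (0 < l < d + e)%N ->
  (forall (i : 'I_d.+1) (j : 'I_e.+1), (i + j = l)%N -> i != minn d l :> nat -> i.+1 != minn d l :> nat -> y i j = 0) ->
  \sum_i \sum_j (y i j *+ (i + j == l)%N) =
    y (inord (minn d l)) (inord (l - minn d l)) +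
    y (inord (minn d l).-1) (inord (l - minn d l).+1).
Proof.
move=> /andP[l0 ln] y0; rewrite pair_bigA /=.
have i0 : (0 < minn d l)%N by lia.
have j0 : (l - minn d l < e)%N by lia.
rewrite (bigD1 (inord (minn d l), inord (l - minn d l))) //=.
rewrite (bigD1 (inord (minn d l).-1, inord (l - minn d l).+1)) /=; last first.
  by rewrite -pair_eqE /= -!val_eqE /= !inordK //; lia.
rewrite !inordK; try lia.
have -> : (minn d l + (l - minn d l) == l)%N by lia.
have -> : ((minn d l).-1 + (l - minn d l).+1 == l)%N by lia.
rewrite !mulr1n big1 ?addr0 // => -[i j] /=; rewrite -!pair_eqE /= -!val_eqE /=.
rewrite !inordK; try lia.
move=> h; case: eqP => [ij|_]; last by rewrite mulr0n.
by rewrite y0 ?mul0rn //; lia.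
Qed.

(** For [0 < l < d + e] two neighbouring entries of the antidiagonal [i + j = l] are found from
    [F l] and [G l] by a linear system of determinant [- nL]; the other entries are 0. The
    antidiagonals [l = 0] and [l = d + e] have one entry each, of weight 0, whence the two
    conditions on [G]. *)
Lemma exists_corr (F G : nat -> L) : G 0%N = 0 -> G (d + e)%N = 0 ->
  exists a : 'M[L]_(d.+1, e.+1), forall l, (l <= d + e)%N ->
    Fcoef a l = F l /\ Gcoef a l = G l.
Proof.
move=> G0 Gn.
have nz : nL != 0 by rewrite /nL; move/pcharf0P: L0 => ->; rewrite addn_eq0; lia.
pose a : 'M[L]_(d.+1, e.+1) := \matrix_(i, j)
  if i == minn d (i + j) :> nat then (G (i + j)%N - (W (i + j) - nL) * F (i + j)%N) / nL
  else if i.+1 == minn d (i + j) :> nat then (W (i + j) * F (i + j)%N - G (i + j)%N) / nL else 0.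
exists a => l ln.
have [->|l0] := posnP l.
  have m0 : minn d 0 = 0%N by lia.
  have s0 : ((ord0 : 'I_d.+1) + (ord0 : 'I_e.+1) = 0)%N by [].
  rewrite Fcoef0 Gcoef0 G0 mxE s0 m0 (_ : ((ord0 : 'I_d.+1) == 0 :> nat) = true) // /W m0 !muln0 G0 subrr; split=> //.
  by field; rewrite -?natrD; exact: nz.
have [->|lm] := eqVneq l (d + e)%N.
  rewrite Fcoef_max Gcoef_max Gn mxE /=; have -> : minn d (d + e) = d by lia.
  rewrite eqxx /W; have -> : minn d (d + e) = d by lia.
  rewrite addKn (mulnC d e) Gn subrr; split=> //.
  by field; rewrite -?natrD; exact: nz.
have lb : (0 < l < d + e)%N by rewrite l0 ltn_neqAle lm ln.
have a0 (i : 'I_d.+1) (j : 'I_e.+1) : (i + j = l)%N -> i != minn d l :> nat -> i.+1 != minn d l :> nat -> a i j = 0.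
  by move=> ij h1 h2; rewrite mxE ij (negbTE h1) (negbTE h2).
have a1 : a (inord (minn d l)) (inord (l - minn d l)) = (G l - (W l - nL) * F l) / nL.
  rewrite mxE !inordK; try lia.
  have -> : (minn d l + (l - minn d l) = l)%N by lia.
  by rewrite eqxx.
have a2 : a (inord (minn d l).-1) (inord (l - minn d l).+1) = (W l * F l - G l) / nL.
  rewrite mxE !inordK; try lia.
  have -> : ((minn d l).-1 + (l - minn d l).+1 = l)%N by lia.
  have -> : ((minn d l).-1 == minn d l) = false by lia.
  by have -> : ((minn d l).-1.+1 == minn d l) by lia.
split.
  by rewrite /Fcoef (antidiag_two lb a0) a1 a2; field; rewrite -?natrD; exact: nz.
transitivity (\sum_i \sum_j ((a i j * ((e * i)%:R - (d * j)%:R)) *+ (i + j == l)%N)).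
  by apply: eq_bigr => i _; apply: eq_bigr => j _; rewrite mulrnAl.
rewrite (antidiag_two lb) => [|i j ij h1 h2]; last by rewrite a0 ?mul0r.
rewrite a1 a2 !inordK; try lia.
have -> : (e * (minn d l).-1)%:R - (d * (l - minn d l).+1)%:R = W l - nL.
  have h : (minn d l = (minn d l).-1.+1)%N by lia.
  rewrite /W /nL; move: h; case: (minn d l) => // i _ /=.
  by rewrite !mulnS !natrD; ring.
by rewrite -/(W l); field; rewrite -?natrD; exact: nz.
Qed.

End Antidiagonal.

Lemma tcoef_surjective (L : fieldType) d e (T : nat -> L) :
  [pchar L] =i pred0 -> (0 < d)%N -> (0 < e)%N -> T 1%N = 0 ->
  (exists2 j, (j <= d + e)%N & T j != 0) ->
  exists (M : fieldType) (f : {rmorphism L -> M}) (a : 'M[M]_(d.+1, e.+1)) (c : M),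
    c != 0 /\ forall j, (j <= d + e)%N -> tcoef a j = c * f (T j).
Proof.
move=> L0 d0 e0 T1 [j0 j0n Tj0]; set n := (d + e)%N in j0n *.
have n1 : (1 < n)%N by rewrite /n; lia.
pose p : {poly L} := \sum_(i < n.+1) (T i)%:P * 'X^(n - i).
have p0 : p != 0.
  apply: contraNneq Tj0 => p0; have := coef_sum_rev T j0n; rewrite -/p p0 coef0 => <-.
  by rewrite eqxx.
have [M [f [rs pE]]] := exists_splitting p0.
have M0 := pchar_rmorph f L0.
have natM i : (i%:R == 0 :> M) = (i == 0%N) by move/pcharf0P: M0.
have lead0 : f (lead_coef p) != 0 by rewrite fmorph_eq0 lead_coef_eq0.
have sp : size p = (size rs).+1.
  by rewrite -(size_map_poly f) pE size_scale // size_prod_XsubC.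
pose m := size rs.
have spn : (size p <= n.+1)%N.
  apply: leq_trans (size_sum _ _ _) _; apply/bigmax_leqP => i _.
  by rewrite mul_polyC; apply: leq_trans (size_scale_leq _ _) _; rewrite size_polyXn ltnS leq_subr.
have mn : (m <= n)%N by rewrite -ltnS /m -sp.
have pn1 : p`_n.-1 = 0 by rewrite -subn1 (coef_sum_rev T (ltnW n1)).
(* This is where [T 1 = 0] enters: the degree [m] of [p] is [n] or at most [n - 2]. *)
have mn1 : m != n.-1.
  apply: contraTneq p0 => mE; rewrite -lead_coef_eq0 lead_coefE sp /= -/m mE pn1 eqxx //.
have natM_inj : injective (fun i : nat => i%:R : M).
  move=> i j /= e1; apply/eqP; wlog ij : i j e1 / (i <= j)%N.
    by move=> h; case: (leqP i j) => [|/ltnW] ij; [|rewrite eq_sym]; apply: h.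
  by rewrite eqn_leq ij -subn_eq0 -natM natrB // e1 subrr eqxx.
(* The simple roots [1, ..., m] and the root [m + 1] with multiplicity [n - m], which is 0 or at
   least 2. The successor keeps 0 from being a root. *)
pose al (i : nat) : M := (minn i m).+1%:R.
have al0 i : al i != 0 by rewrite natM.
pose Fp : {poly M} := 1 *: \prod_(i < n) ('X - (al i)%:P).
have F'E (i : 'I_n) : Fp^`().[al i] = \prod_(j < n | j != i) (al i - al j).
  by rewrite deriv_prod_root mul1r.
have F'lt (i : 'I_n) : (i < m)%N -> Fp^`().[al i] != 0.
  move=> im; rewrite F'E; apply/prodf_neq0 => j; apply: contraNneq => /eqP.
  rewrite subr_eq0 => /eqP/natM_inj[] e1; rewrite -val_eqE /=; apply/eqP; lia.
have F'ge (i : 'I_n) : (m <= i)%N -> Fp^`().[al i] = 0.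
  move=> im; have i_n := ltn_ord i; rewrite F'E.
  have [k kn ki] : exists2 k : 'I_n, (m <= k)%N & k != i.
    have [iE|iE] := eqVneq (i : nat) m.
      have h : (m.+1 < n)%N by lia.
      by exists (Ordinal h); rewrite // -val_eqE /= iE; lia.
    have h : (m < n)%N by lia.
    by exists (Ordinal h) => //; rewrite -val_eqE /= eq_sym.
  rewrite (bigD1 k) //= /al; have -> : minn i m = minn k m by lia.
  by rewrite subrr mul0r.
(* At a simple root the value of [H] turns the factor [2 F'(al i) X + H(al i)] into a multiple of
   [X - rs_i]; at the multiple root, where [F'] vanishes, it turns the factor into 1. *)
have [H [sH Hlt Hge]] : exists H : {poly M}, [/\ (size H <= n.-1)%N,
    forall i : 'I_n, (i < m)%N -> H.[al i] = 2%:R * Fp^`().[al i] * - rs`_i &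
    forall i : 'I_n, (m <= i)%N -> H.[al i] = 1].
  have [mE|mE] := eqVneq m n.
    have inj : injective (fun i : 'I_n => al i).
      by move=> i j /natM_inj[] e1; apply: ord_inj; have := ltn_ord i; have := ltn_ord j; lia.
    have [H [sH HE HS]] := interpolation (fun i : 'I_n => 2%:R * Fp^`().[al i] * - rs`_i) inj.
    exists H; split=> // [|i]; last by have := ltn_ord i; lia.
    (* Interpolation at [n] points leaves one degree too many. The top coefficient is -2 times the
       sum of the roots of [p], which is zero because [p] has no term of degree [n - 1]. *)
    have H0 : H`_n.-1 = 0.
      rewrite HS.
      transitivity (\sum_(i < n) - (2%:R * rs`_i)).
        apply: eq_bigr => i _; rewrite -F'E.
        have : Fp^`().[al i] != 0 by rewrite F'lt // mE.
        by move: (Fp^`().[_]) => x x0; field.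
      rewrite sumrN -mulr_sumr.
      have := pn1 => /(congr1 f); rewrite -coef_map /= pE coefZ rmorph0.
      have -> : (\prod_(r <- rs) ('X - r%:P))`_n.-1 = - \sum_(r <- rs) r.
        by rewrite -mE coefPn_prod_XsubC //; rewrite -/m; lia.
      move/eqP; rewrite mulf_eq0 (negbTE lead0) oppr_eq0 /= => /eqP.
      by rewrite (big_nth 0) big_mkord -/m mE => ->; rewrite mulr0 oppr0.
    apply/leq_sizeP => j; rewrite leq_eqVlt => /predU1P[<- //|jn].
    by rewrite nth_default //; apply: leq_trans sH _; lia.
  (* Here [m <= n - 2], so interpolation at the [m + 1] distinct roots already meets the degree
     bound. *)
  have inj : injective (fun i : 'I_m.+1 => al i).
    by move=> i j /natM_inj[] e1; apply: ord_inj; have := ltn_ord i; have := ltn_ord j; lia.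
  have [H [sH HE _]] := interpolation (fun i : 'I_m.+1 =>
     if (i < m)%N then 2%:R * Fp^`().[al i] * - rs`_i else 1) inj.
  exists H; split=> [|i im|i im]; first by apply: leq_trans sH _; lia.
    have im1 : (i < m.+1)%N by apply: ltnW.
    by rewrite (HE (Ordinal im1)) /= im.
  have -> : al i = al (@ord_max m) by rewrite /al /=; congr (_%:R); lia.
  by rewrite HE /= ltnn.
have szF : size Fp = n.+1 by rewrite /Fp scale1r size_prod_ord.
(* The coefficients of [z0 z1 H], hence the shift by one. *)
pose G l := if l is l'.+1 then H`_l' else 0.
have Gn : G n = 0.
  by rewrite /G; case: (n) n1 sH => // n' _ sH; rewrite nth_default.
have [a aE] := @exists_corr M d e M0 d0 e0 (fun l => Fp`_l) G erefl Gn.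
have FaE : Fpoly a = 1 *: \prod_(i < d + e) ('X - (al i)%:P).
  apply/polyP => l; rewrite coef_poly ltnS; case: leqP => h; first by have [-> _] := aE l h.
  by rewrite -/Fp nth_default // szF.
have HaE : Hpoly a = H.
  apply/polyP => l; rewrite coef_poly; case: ltnP => h.
    by have [_ ->] := aE l.+1 ltac:(lia).
  by rewrite nth_default //; apply: leq_trans sH h.
have main := tcoef_roots M0 n1 (oner_neq0 M) (fun i => al0 i) FaE.
rewrite expr1n mul1r HaE FaE -/Fp in main.
pose C : M := \prod_(i < n | (i < m)%N) (2%:R * Fp^`().[al i]).
have prodE : \prod_(i < d + e) ((2%:R * Fp^`().[al i])%:P * 'X + (H.[al i])%:P) =
    C%:P * \prod_(r <- rs) ('X - r%:P).
  rewrite (big_nth 0) big_mkord -/m (big_ord_widen _ (fun i => 'X - (rs`_i)%:P) mn).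
  rewrite rmorph_prod -big_split /= (bigID (fun i : 'I_n => (i < m)%N)) /=.
  rewrite [X in _ * X]big1 ?mulr1 => [|i]; last first.
    by rewrite -leqNgt => im; rewrite F'ge // Hge // mulr0 rmorph0 mul0r add0r rmorph1.
  by apply: eq_bigr => i im; rewrite Hlt // mulrBr -!rmorphM -rmorphN -mulrN.
have C0 : C != 0.
  by apply/prodf_neq0 => i im; rewrite mulf_neq0 ?F'lt // natM.
exists M, f, a, (C / f (lead_coef p)); split; first by rewrite mulf_neq0 ?invr_neq0.
move=> j jn; rewrite -(coef_sum_rev (tcoef a) jn) main prodE coefCM -mulrA; congr (_ * _).
have -> : f (T j) = f (lead_coef p) * (\prod_(r <- rs) ('X - r%:P))`_(n - j).
  by rewrite -coefZ -pE coef_map (coef_sum_rev T jn).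
by rewrite mulKf.
Qed.

(** * Points of Proj *)

(** Points of [Proj] are propositional predicates, whereas the quotient by an ideal is formed from a
    boolean one. *)
Definition asbool (P : Prop) : bool := if excluded_middle_informative P then true else false.

Lemma asboolP (P : Prop) : reflect P (asbool P).
Proof. by rewrite /asbool; case: excluded_middle_informative => h; constructor. Qed.

Section PrimeQuotient.
Variables (R : comNzRingType) (q : R -> Prop).
Hypotheses (q0 : q 0) (qD : forall x y, q x -> q y -> q (x + y)).
Hypothesis (qM : forall x y, q y -> q (x * y)).
Hypotheses (q1 : ~ q 1) (q_prime : forall x y, q (x * y) -> q x \/ q y).

Definition prime_pred : {pred R} := fun x => asbool (q x).

Local Notation S := prime_pred.

Let S_idealr : idealr_closed S.
Proof.
split; first exact/asboolP.
- exact/asboolP.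
- move=> a x y /asboolP qx /asboolP qy; apply/asboolP; apply: qD => //; exact: qM.
Qed.

HB.instance Definition _ := isIdealr.Build R S S_idealr.

Let S_prime : prime_idealr_closed S.
Proof.
by move=> x y /asboolP /q_prime [] h; apply/orP; [left|right]; apply/asboolP.
Qed.

HB.instance Definition _ := isPrimeIdealrClosed.Build R S S_prime.

Local Open Scope quotient_scope.

Definition prime_quotient := {ideal_quot S}.

Local Notation Q := prime_quotient.

HB.instance Definition _ := GRing.ComNzRing.on Q.

(** Units and inverses are obtained by choice; they equip the quotient for becoming an integral
    domain with a fraction field. *)
Let Q_unit : pred Q := fun x => asbool (exists y, y * x = 1).
Let Q_inv (x : Q) : Q :=
  if excluded_middle_informative (exists y, y * x = 1) is left h
  then proj1_sig (constructive_indefinite_description _ h) else x.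

Let Q_mulVr : {in Q_unit, left_inverse 1 Q_inv *%R}.
Proof.
move=> x /asboolP h; rewrite /Q_inv; case: excluded_middle_informative => // h'.
by case: constructive_indefinite_description.
Qed.

Let Q_unitPl (x y : Q) : y * x = 1 -> Q_unit x.
Proof. by move=> h; apply/asboolP; exists y. Qed.

Let Q_invr_out : {in [predC Q_unit], Q_inv =1 id}.
Proof.
by move=> x /negP h; rewrite /Q_inv; case: excluded_middle_informative => // h'; case: h; apply/asboolP.
Qed.

HB.instance Definition _ := GRing.ComNzRing_hasMulInverse.Build Q Q_mulVr Q_unitPl Q_invr_out.

HB.instance Definition _ := GRing.ComUnitRing_isIntegral.Build Q
  (@Quotient.rquot_IdomainAxiom R S).

Lemma prime_residue_field :
  exists (L : fieldType) (f : {rmorphism R -> L}), forall x, q x <-> f x = 0.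
Proof.
exists {fraction Q}, (@tofrac Q \o \pi_{ideal_quot S}) => x /=.
split=> [qx|/eqP].
  apply/eqP; rewrite tofrac_eq0 -(rmorph0 \pi_{ideal_quot S}) -Quotient.idealrBE subr0; exact/asboolP.
by rewrite tofrac_eq0 -(rmorph0 \pi_{ideal_quot S}) -Quotient.idealrBE subr0 => /asboolP.
Qed.

End PrimeQuotient.

Lemma dhomog_comp (R : comNzRingType) (N N' n m : nat) (p : {mpoly R[N]})
    (lq : N.-tuple {mpoly R[N']}) :
  (forall i, tnth lq i \is m.-homog) -> p \is n.-homog -> p \mPo lq \is (m * n).-homog.
Proof.
move=> lqm /dhomogP pn; rewrite comp_mpolyEX big_seq; apply: rpred_sum => u /pn /= un.
rewrite comp_mpolyX; apply: rpredZ; rewrite -un mdegE big_distrr /=.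
by apply: dhomog_bigprod => i; apply: dhomogMn.
Qed.

Lemma sum_pihomog (R : comNzRingType) (N : nat) (p : {mpoly R[N]}) :
  p = \sum_(i < mmeasure mdeg p) pihomog mdeg i p.
Proof. exact: pihomog_partitionE. Qed.

(** Substituting linear forms preserves degrees. *)
Lemma pihomog_comp (R : comNzRingType) (N N' n : nat) (p : {mpoly R[N]})
    (lq : N.-tuple {mpoly R[N']}) :
  (forall i, tnth lq i \is 1.-homog) ->
  pihomog mdeg n (p \mPo lq) = pihomog mdeg n p \mPo lq.
Proof.
move=> lq1.
have hom i : pihomog mdeg i p \mPo lq \is i.-homog.
  by rewrite -{2}[i]mul1n; apply: dhomog_comp => //; apply: pihomogP.
have piE i : pihomog mdeg n (pihomog mdeg i p \mPo lq) =
    pihomog mdeg n (pihomog mdeg i p) \mPo lq.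
  have [->|ni] := eqVneq n i; first by rewrite (pihomog_dE (hom i)) pihomog_id.
  by rewrite (pihomog_ne0 _ (hom i)) 1?eq_sym // (pihomog_ne0 _ (pihomogP _ _ _)) 1?eq_sym // comp_mpoly0.
move: (mmeasure mdeg p) (sum_pihomog p) => K E.
rewrite [in LHS]E [in RHS]E (raddf_sum (comp_mpoly lq)) !(raddf_sum (pihomog mdeg n)).
rewrite (raddf_sum (comp_mpoly lq)) /=.
by apply: eq_bigr => i _; rewrite piE.
Qed.

Lemma rmorph_comp_mpoly (R C : comNzRingType) (N N' : nat) (f : {rmorphism {mpoly R[N']} -> C})
    (lq : N.-tuple {mpoly R[N']}) (p : {mpoly R[N]}) :
  f (p \mPo lq) = mmap (f \o @mpolyC N' R) (fun i => f (tnth lq i)) p.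
Proof.
rewrite comp_mpolyEX (rmorph_sum f) /mmap; apply: eq_bigr => u _.
rewrite -mul_mpolyC rmorphM comp_mpolyX rmorph_prod; congr (_ * _).
by apply: eq_bigr => i _; rewrite rmorphXn.
Qed.

Lemma mmap_dhomog (R C : comNzRingType) (N n : nat) (f : {rmorphism R -> C}) (h : 'I_N -> C)
    (c : C) (p : {mpoly R[N]}) : p \is n.-homog ->
  mmap f (fun i => h i * c) p = mmap f h p * c ^+ n.
Proof.
move=> /dhomogP pn; rewrite /mmap mulr_suml [LHS]big_seq [RHS]big_seq.
apply: eq_bigr => u /pn /= <-; rewrite -mulrA; congr (_ * _).
rewrite /mmap1 mdegE -prodrXr -big_split; apply: eq_bigr => i _.
by rewrite exprMn.
Qed.

Lemma corr_act_linear (C : comNzRingType) d e (g : 'M[C]_2) i j :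
  exists w : 'I_d.+1 -> 'I_e.+1 -> C, forall a : 'M[C]_(d.+1, e.+1),
    corr_act g a i j = \sum_i' \sum_j' a i' j' * w i' j'.
Proof.
eexists => a; rewrite mxE /corr_form (raddf_sum (comp_mpoly _)) (raddf_sum (mcoeff _)).
apply: eq_bigr => i' _; rewrite (raddf_sum (comp_mpoly _)) (raddf_sum (mcoeff _)).
apply: eq_bigr => j' _ /=; rewrite comp_mpolyZ mcoeffZ; reflexivity.
Qed.

Lemma corr_act_delta (C : comNzRingType) d e (g : 'M[C]_2) (a : 'M[C]_(d.+1, e.+1)) i j :
  corr_act g a i j = \sum_i' \sum_j' a i' j' * corr_act g (delta_mx i' j') i j.
Proof.
have [w wE] := @corr_act_linear C d e g i j; rewrite wE.
apply: eq_bigr => i' _; apply: eq_bigr => j' _; congr (_ * _); rewrite wE.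
rewrite (bigD1 i') //= (bigD1 j') //= mxE !eqxx mul1r !big1 ?addr0 // => [i2|j2] ne.
  by rewrite big1 // => j2 _; rewrite mxE (negbTE ne) mul0r.
by rewrite mxE (negbTE ne) andbF mul0r.
Qed.

Section Action.
Variables (k : fieldType) (d e : nat).
Local Notation A := (corr_ring k d e).
Local Notation gen := (generic_corr k d e).

Definition act_tuple (g : 'M[k]_2) : (d.+1 * e.+1).-tuple A :=
  [tuple mxvec (corr_act (map_mx (@mpolyC _ k) g) gen) 0 l | l < d.+1 * e.+1].

(** The action is linear in the form and its matrix has entries in [k], so the new coefficients are
    linear forms in the generic ones. *)
Lemma dhomog_act_tuple g l : tnth (act_tuple g) l \is 1.-homog.
Proof.
rewrite tnth_mktuple; case/mxvec_indexP: l => i j; rewrite mxvecE corr_act_delta.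
apply: rpred_sum => i' _; apply: rpred_sum => j' _.
have -> : delta_mx i' j' = map_mx (@mpolyC (d.+1 * e.+1) k) (delta_mx i' j').
  by rewrite map_delta_mx.
by rewrite -corr_act_map [X in _ * X]mxE mulrC mul_mpolyC dhomogZ // dhomog_gen.
Qed.

Lemma SL2_invariant_pihomog (F : A) n : SL2_invariant F -> SL2_invariant (pihomog mdeg n F).
Proof.
by move=> FI g dg; rewrite -(pihomog_comp _ _ (dhomog_act_tuple g)); congr (pihomog _ _ _); apply: FI.
Qed.

Lemma SL2_invariant0 : SL2_invariant (0 : A).
Proof. by move=> g _; rewrite comp_mpoly0. Qed.

Lemma SL2_invariantD (F G : A) : SL2_invariant F -> SL2_invariant G -> SL2_invariant (F + G).
Proof. by move=> hF hG g dg; rewrite comp_mpolyD hF // hG. Qed.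

Lemma SL2_invariantM (F G : A) : SL2_invariant F -> SL2_invariant G -> SL2_invariant (F * G).
Proof. by move=> hF hG g dg; rewrite rmorphM /= hF // hG. Qed.

Lemma SL2_invariant_comp (N : nat) (F : {mpoly k[N]}) (t : N.-tuple A) :
  (forall i, SL2_invariant (tnth t i)) -> SL2_invariant (F \mPo t).
Proof.
move=> tI g dg; rewrite (comp_mpolyEX F t) (raddf_sum (comp_mpoly _)); apply: eq_bigr => u _ /=.
rewrite comp_mpolyZ comp_mpolyX rmorph_prod; congr (_ *: _); apply: eq_bigr => i _.
by rewrite rmorphXn /= tI.
Qed.

End Action.

(* The point of Proj given by the values at a, over an extension field: an
   invariant lies in the ideal when it vanishes on the line spanned by a. *)
Section PointOfMatrix.
Variables (k L : fieldType) (d e : nat) (f : {rmorphism k -> L}) (a : 'M[L]_(d.+1, e.+1)).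
Local Notation A := (corr_ring k d e).

Let ev (x : A) : L := mmap f (fun l => mxvec a 0 l) x.
Let evX (x : A) : {poly L} := mmap (polyC \o f) (fun l => (mxvec a 0 l)%:P * 'X) x.

Lemma evX_dhomog (x : A) n : x \is n.-homog -> evX x = (ev x)%:P * 'X^n.
Proof.
move=> xn; rewrite /evX (mmap_dhomog _ (fun l => (mxvec a 0 l)%:P) _ xn); congr (_ * _).
rewrite /ev /mmap rmorph_sum; apply: eq_bigr => u _ /=.
rewrite rmorphM /= rmorph_prod; congr (_ * _); apply: eq_bigr => i _.
by rewrite rmorphXn.
Qed.

(** Components of different degrees land on different powers of ['X]. The ideal of the point is
    therefore cut out by [evX], whose kernel is homogeneous, and not by [ev]. *)
Lemma evX_pihomog (x : A) n : evX x = 0 -> evX (pihomog mdeg n x) = 0.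
Proof.
move=> x0; rewrite (evX_dhomog (pihomogP _ _ _)).
have [h|h] := ltnP n (mmeasure mdeg x); last first.
  rewrite (_ : pihomog mdeg n x = 0); first by rewrite /ev raddf0 mul0r.
  rewrite {1}(sum_pihomog x) raddf_sum big1 // => i _ /=.
  by rewrite (pihomog_ne0 _ (pihomogP _ _ _)) // neq_ltn (leq_trans (ltn_ord i) h).
have := x0; rewrite {1}(sum_pihomog x) /evX raddf_sum /= => /(congr1 (fun p : {poly L} => p`_n)).
rewrite coef_sum coef0 (bigD1 (Ordinal h)) //= -/(evX _) (evX_dhomog (pihomogP _ _ _)).
rewrite coefCM coefXn eqxx mulr1 big1 ?addr0 => [->|i]; first by rewrite mul0r.
rewrite -val_eqE /= => ni; rewrite -/(evX _) (evX_dhomog (pihomogP _ _ _)) coefCM coefXn.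
by rewrite eq_sym (negbTE ni) mulr0.
Qed.

Lemma exists_Dyn_point : (exists x n, [/\ (0 < n)%N, SL2_invariant x, x \is n.-homog & ev x != 0]) ->
  exists p : Dyn k d e, forall x n, SL2_invariant x -> x \is n.-homog -> p x <-> ev x = 0.
Proof.
move=> [x0 [n0 [n00 x0I x0h x00]]].
have evX0 x n : x \is n.-homog -> (evX x = 0 <-> ev x = 0).
  move=> xn; rewrite (evX_dhomog xn); split=> [/eqP|->]; last by rewrite mul0r.
  by rewrite mulf_eq0 expf_eq0 polyX_eq0 andbF orbF polyC_eq0 => /eqP.
pose P (x : A) := SL2_invariant x /\ evX x = 0.
have P0 : P 0 by split; [exact: SL2_invariant0 | rewrite /evX raddf0].
have PD x y : P x -> P y -> P (x + y).
  move=> [xI x_0] [yI y_0]; split; first exact: SL2_invariantD.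
  have -> : evX (x + y) = evX x + evX y by rewrite /evX raddfD.
  by rewrite x_0 y_0 addr0.
have PM x y : SL2_invariant x -> P y -> P (x * y).
  move=> xI [yI y_0]; split; first exact: SL2_invariantM.
  have -> : evX (x * y) = evX x * evX y by rewrite /evX rmorphM.
  by rewrite y_0 mulr0.
have P1 : ~ P 1 by move=> [_ /eqP]; rewrite /evX rmorph1 oner_eq0.
have Pp x y : SL2_invariant x -> SL2_invariant y -> P (x * y) -> P x \/ P y.
  have -> : P (x * y) = (SL2_invariant (x * y) /\ evX x * evX y = 0).
    by rewrite /P /evX rmorphM.
  move=> xI yI [_ /eqP]; rewrite mulf_eq0 => /orP[]/eqP h.
    by left.
  by right.
have Ph x n : P x -> P (pihomog mdeg n x).
  by move=> [xI x_0]; split; [exact: SL2_invariant_pihomog | exact: evX_pihomog].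
have Pr : exists x n, [/\ (0 < n)%N, SL2_invariant x, x \is n.-homog & ~ P x].
  by exists x0, n0; split=> // -[_ /(evX0 _ _ x0h)] h; rewrite h eqxx in x00.
exists (ProjPoint (fun x (h : P x) => proj1 h) P0 PD PM P1 Pp Ph Pr) => x n xI xn /=.
by split=> [[_ /(evX0 _ _ xn)]|h] //; split=> //; apply/(evX0 _ _ xn).
Qed.

End PointOfMatrix.

Lemma mmap_comp_field (k L M : fieldType) (N : nat) (f0 : {rmorphism k -> L})
    (f : {rmorphism L -> M}) (T : 'I_N -> L) (p : {mpoly k[N]}) :
  mmap (f \o f0) (fun i => f (T i)) p = f (mmap f0 T p).
Proof.
rewrite /mmap rmorph_sum; apply: eq_bigr => u _.
rewrite rmorphM rmorph_prod; congr (_ * _); apply: eq_bigr => i _.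
by rewrite rmorphXn.
Qed.

(** The [T j] are the classes of the coordinates in the fraction field of the quotient by the prime.
    If all of them were zero, the prime would contain every form of positive degree. *)
Lemma PD_residue (k : fieldType) d e (q : PD k d e) :
  exists (L : fieldType) (f : {rmorphism k -> L}) (T : 'I_(d + e).+1 -> L),
    (forall F, q F <-> mmap f T F = 0) /\ exists j, T j != 0.
Proof.
have [L [f fE]] := @prime_residue_field _ (prime_of q) (prime0 q) (@primeD _ _ _ q)
  (fun x y h => @primeMl _ _ _ q x y I h) (@prime1 _ _ _ q)
  (fun x y h => @prime_prime _ _ _ q x y I I h).
pose f0 : {rmorphism k -> L} := f \o @mpolyC _ k.
pose T i := f 'X_i.
have fT F : f F = mmap f0 T F.
  rewrite [in LHS](mpolyE F) rmorph_sum; apply: eq_bigr => u _.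
  rewrite -mul_mpolyC rmorphM; congr (_ * _); rewrite mpolyXE_id rmorph_prod.
  by apply: eq_bigr => i _; rewrite rmorphXn.
exists L, f0, T; split=> [F|]; first by rewrite -fT.
apply: NNPP => noT.
have T0 i : T i = 0 by apply/eqP/negPn/negP => h; apply: noT; exists i.
have [x [n [n0 _ xn]]] := prime_relevant q; apply; apply/fE; rewrite fT.
have -> : mmap f0 T x = mmap f0 (fun i => T i * 0) x.
  by rewrite /mmap; apply: eq_bigr => u _; congr (_ * _); apply: mmap1_eq => i; rewrite T0 mul0r.
by rewrite (mmap_dhomog _ _ _ xn) expr0n eqn0Ngt n0 mulr0.
Qed.

(** * The two inclusions *)

Section Main.
Variables (k : fieldType) (d e : nat).
Hypothesis k0 : [pchar k] =i pred0.
Hypotheses (d_gt0 : (0 < d)%N) (e_gt0 : (0 < e)%N).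
Local Notation A := (corr_ring k d e).
Local Notation gen := (generic_corr k d e).

Let n_gt1 : (1 < d + e)%N.
Proof. by move: d_gt0 e_gt0; lia. Qed.

Lemma Fcoef_gen_neq0 : Fcoef gen 0 * Fcoef gen (d + e) != 0.
Proof.
rewrite Fcoef0_fev Fcoef_max_fev -[0](rmorph0 (@mpolyC _ k)) -[1](rmorph1 (@mpolyC _ k)).
by rewrite mulf_neq0 // fev_gen_neq0 ?oner_eq0 ?orbT.
Qed.

Lemma represents_tcoefs : represents (tcoefs k d e).
Proof.
split=> [j||].
- by rewrite tnth_mktuple; apply: SL2_invariant_tcoef; rewrite // -ltnS.
- by exists ((d + e).-1.*2) => j; apply: dhomog_tcoefs.
- exists (Fcoef gen 0 * Fcoef gen (d + e)), 1.
  by rewrite Fcoef_gen_neq0 oner_eq0 multiplier_resE // scale1r.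
Qed.

(** Any representing tuple is proportional to [tcoefs], with a nonzero factor on its own side, and
    the polynomial ring is a domain. *)
Lemma represents_coord1 (t : (d + e).+1.-tuple A) : represents t -> tnth t (inord 1) = 0.
Proof.
move=> [_ _ [u [v [u0 _ E]]]].
have : u * tnth t (inord 1) = 0.
  rewrite -(D_coord_elt k0 d_gt0) E multiplier_resE // scalerA D_coord_elt // tnth_mktuple.
  by rewrite inordK ?tcoef1_generic ?mulr0 // ltnS ltnW.
by move/eqP; rewrite mulf_eq0 (negbTE u0) => /eqP.
Qed.

Lemma multiplier_image_hyperplane (q : PD k d e) : multiplier_image q -> multiplier_hyperplane q.
Proof.
move=> [p [t [trep _ qE]]]; apply/qE => n.
rewrite pihomogX; case: ifP => _; last by rewrite comp_mpoly0; apply: prime0.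
by rewrite comp_mpolyXU -tnth_nth represents_coord1 //; apply: prime0.
Qed.

Lemma hyperplane_multiplier_image (q : PD k d e) : multiplier_hyperplane q -> multiplier_image q.
Proof.
move=> q1; have [L [f0 [T [qT [j0 Tj0]]]]] := PD_residue q.
pose T' i := T (inord i).
have T'E (i : 'I_(d + e).+1) : T' i = T i by rewrite /T' inord_val.
have T1 : T' 1%N = 0 by move/qT: q1; rewrite mmapX mmap1U.
have [|M [f [a [c [c0 aE]]]]] := tcoef_surjective (pchar_rmorph f0 k0) d_gt0 e_gt0 T1.
  by exists j0; rewrite ?T'E // -ltnS.
pose ev (x : A) := mmap (f \o f0) (fun l => mxvec a 0 l) x.
have evt (j : 'I_(d + e).+1) : ev (tnth (tcoefs k d e) j) = f (T j) * c.
  rewrite tnth_mktuple /ev; apply: etrans (tcoef_map (mmap (f \o f0) (fun l => mxvec a 0 l)) gen j) _.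
  by rewrite mmap_gen aE -1?ltnS // T'E mulrC.
have tI (j : 'I_(d + e).+1) : SL2_invariant (tnth (tcoefs k d e) j).
  by have [h _ _] := represents_tcoefs.
have th (j : 'I_(d + e).+1) : tnth (tcoefs k d e) j \is ((d + e).-1.*2).-homog.
  exact: dhomog_tcoefs.
have t0 : ev (tnth (tcoefs k d e) j0) != 0 by rewrite evt mulf_neq0 // fmorph_eq0.
(* Semistability of [a]: the invariant [tcoef gen j0] has positive degree and does not vanish at
   [a]. *)
have [|p pE] := @exists_Dyn_point k M d e (f \o f0) a.
  exists (tnth (tcoefs k d e) j0), ((d + e).-1.*2); split=> //.
  by rewrite double_gt0; move: n_gt1; case: (d + e)%N => [|[]].
exists p, (tcoefs k d e); split; first exact: represents_tcoefs.
  by exists j0 => /(pE _ _ (tI j0) (th j0)) h; move: t0; rewrite /ev h eqxx.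
(* On forms of degree [n], evaluation at the coordinates of [a] and at the [T j] differ by the
   injective map [f] and the nonzero factor [c ^+ n]. *)
have key F n : p (pihomog mdeg n F \mPo tcoefs k d e) <-> q (pihomog mdeg n F).
  set y := pihomog mdeg n F; have yn : y \is n.-homog by apply: pihomogP.
  have evy : ev (y \mPo tcoefs k d e) = f (mmap f0 T y) * c ^+ n.
    rewrite /ev rmorph_comp_mpoly -mmap_comp_field -(mmap_dhomog _ _ _ yn) /mmap.
    apply: eq_bigr => u _; congr (_ * _); first by rewrite /= mmapC.
    by apply: mmap1_eq => i; apply: evt.
  have yI : SL2_invariant (y \mPo tcoefs k d e) by apply: SL2_invariant_comp.
  have [h1 h2] := pE _ _ yI (dhomog_comp th yn).
  split=> [/h1|/qT h].
    rewrite -[mmap _ _ _]/(ev _) evy => /eqP; rewrite mulf_eq0 expf_eq0 (negbTE c0) andbF orbF.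
    by rewrite fmorph_eq0 => /eqP h; apply/qT.
  by apply: h2; rewrite -[mmap _ _ _]/(ev _) evy h rmorph0 mul0r.
(* As [q] is a homogeneous ideal, membership is decided on homogeneous components. *)
move=> F; split=> [qF n|h]; first by apply/key; apply: prime_homog.
rewrite (sum_pihomog F); apply: (big_ind (prime_of q)) => [|x y|i _].
- exact: prime0.
- exact: primeD.
- by apply/key.
Qed.

End Main.

Theorem theorem6p5 (k : fieldType) (hk : [pchar k] =i pred0)
    (d e : nat) (hd : (1 <= d)%N) (he : (1 <= e)%N) :
  forall q : PD k d e, multiplier_image q <-> multiplier_hyperplane q.
Proof.
by move=> q; split; [exact: multiplier_image_hyperplane | exact: hyperplane_multiplier_image].
Qed.
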